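(* Let $i\in\{1,\dots,d\}$ and suppose that $\gamma_i^+=-\gamma_i^-$, that is, $\gamma_i^+|_e=-\gamma_i^-|_e$ for all $e\in\mathcal{E}_h^I$. Then the integration by parts formulas $$(\partial_{h,x_i}^\pm v_h,\varphi_h)_{\mathcal{T}_h}=-(v_h,\partial_{h,x_i}^\mp\varphi_h)_{\mathcal{T}_h}+\langle v_h,\varphi_hn^{(i)}\rangle_{\mathcal{E}_h^B}$$ and $$(\partial_{h,x_i}v_h,\varphi_h)_{\mathcal{T}_h}=-(v_h,\partial_{h,x_i}\varphi_h)_{\mathcal{T}_h}+\langle v_h,\varphi_hn^{(i)}\rangle_{\mathcal{E}_h^B}$$ hold for all $v_h,\varphi_h\in V_r^h$.
   Context: Mesh and spaces. $\Omega\subset\mathbf{R}^d$ is a bounded open domain and $\mathcal{T}_h$ is a locally quasi-uniform, shape-regular partition of $\Omega$ into (finitely many, polytopal) elements with flat faces. $\mathcal{E}_h^I$, $\mathcal{E}_h^B$ denote the sets of interior and boundary faces/edges, $\mathcal{E}_h=\mathcal{E}_h^I\cup\mathcal{E}_h^B$. $W^{m,p}(\mathcal{T}_h)=\prod_{K}W^{m,p}(K)$, $C^m(\mathcal{T}_h)=\prod_K C^m(\overline K)$. For a fixed integer $r\ge 0$, $V_r^h=\prod_{K\in\mathcal{T}_h}\mathbb{P}_r(K)$, where $\mathbb{P}_r(K)$ is the set of polynomials on $K$ of degree at most $r$. $\mathcal{V}_h=W^{1,1}(\mathcal{T}_h)\cap C^0(\mathcal{T}_h)$ (so $V_r^h\subset\mathcal{V}_h$).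 $(v,w)_{\mathcal{T}_h}=\sum_K\int_K vw\,dx$, and $\langle v,w\rangle_{\mathcal{S}}=\sum_{e\in\mathcal{S}}\int_e vw\,ds$ for $\mathcal{S}\subset\mathcal{E}_h$; derivatives of piecewise functions inside $(\cdot,\cdot)_{\mathcal{T}_h}$ are taken elementwise. Jumps, averages, normals. Elements are globally numbered. For $e=\partial K\cap\partial K'\in\mathcal{E}_h^I$ with $K$ having the smaller number: $[v]=v|_K-v|_{K'}$, $\{v\}=\frac12(v|_K+v|_{K'})$, $n_e=n_K|_e=-n_{K'}|_e$ ($n_K$ is the outward unit normal of $K$). On $e\in\mathcal{E}_h^B$: $[v]=\{v\}=v$ and $n_e$ is the outward unit normal of $\Omega$. $n^{(i)}$ is the piecewise constant function on faces with $n^{(i)}|_e=n_e^{(i)}$, the $i$th component of $n_e$. Trace operators. On $e=\partial K\cap \partial K'\in\mathcal{E}_h^I$ ($K$ with smaller number): $\mathcal{Q}_i^-(v)$ is the trace of $v|_K$ if $n_e^{(i)}<0$ and of $v|_{K'}$ if $n_e^{(i)}\ge0$; $\mathcal{Q}_i^+(v)$ is the trace of $v|_{K'}$ if $n_e^{(i)}<0$ and of $v|_K$ if $n_e^{(i)}\ge 0$. On $e\in\mathcal{E}_h^B$, $\mathcal{Q}_i^\pm(v)$ is the trace of $v$. Discrete derivatives. Let $\gamma_i^\pm$ be given functions that are piecewise constant with respect to $\mathcal{E}_h^I$. For $v\in\mathcal{V}_h$, $\partial_{h,x_i}^\pm v\in V_r^h$ is defined by $$(\partial_{h,x_i}^\pm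 v,\varphi_h)_{\mathcal{T}_h}=\langle\mathcal{Q}_i^\pm(v)n^{(i)},[\varphi_h]\rangle_{\mathcal{E}_h}-(v,\partial_{x_i}\varphi_h)_{\mathcal{T}_h}+\langle\gamma_i^\pm[v],[\varphi_h]\rangle_{\mathcal{E}_h^I}\quad\forall\varphi_h\in V_r^h,$$ and $\partial_{h,x_i}v=\frac12(\partial_{h,x_i}^-v+\partial_{h,x_i}^+v)$. In formulas with $\pm$ and $\mp$, either all upper or all lower signs are taken. *)

(* Defs.v *)
From HB Require Import structures.
From mathcomp Require Import all_boot all_order all_algebra.
From mathcomp Require Import all_classical all_reals all_analysis.
From mathcomp Require mpoly.
Set Implicit Arguments.
Unset Strict Implicit.
Unset Printing Implicit Defensive.
Import Order.TTheory GRing.Theory Num.Theory.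
Import numFieldNormedType.Exports.
Local Open Scope classical_set_scope.
Local Open Scope ring_scope.

Section lebesgue_tuple.
Context {R : realType}.
Local Notation RR := (measurableTypeR R).

Definition tuple_cons n (p : RR * n.-tuple RR) : n.+1.-tuple RR :=
  [tuple of p.1 :: p.2].

Lemma measurable_tuple_cons n : measurable_fun setT (@tuple_cons n).
Proof. exact: measurable_cons. Qed.

(* The library has binary product measures and the product sigma-algebra on
   n.-tuple T, but no n-fold product measure. *)
Section tuple_product.
Variables (nu : {sigma_finite_measure set RR -> \bar R}) (n : nat)
  (mu : {sigma_finite_measure set (n.-tuple RR) -> \bar R}).

Definition tuple_product : set (n.+1.-tuple RR) -> \bar R :=
  pushforward (nu \x mu)%E (@tuple_cons n).

Let mpf : {measure set (n.+1.-tuple RR) -> \bar R} :=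
  measure_function_pushforward__canonical__measure_function_Measure
    (nu \x mu)%E (@measurable_tuple_cons n).

Let tuple_product0 : tuple_product set0 = 0%E.
Proof. exact: (measure0 mpf). Qed.

Let tuple_product_ge0 A : (0 <= tuple_product A)%E.
Proof. exact: (measure_ge0 mpf). Qed.

Let tuple_product_additive : semi_sigma_additive tuple_product.
Proof. exact: (@measure_semi_sigma_additive _ _ _ mpf). Qed.

HB.instance Definition _ :=
  isMeasure.Build _ _ _ tuple_product
    tuple_product0 tuple_product_ge0 tuple_product_additive.

Let tuple_product_sigma_finite : sigma_finite setT tuple_product.
Proof.
have /sigma_finiteP[F [TF ndF Foo]] := sigma_finiteT nu.
have /sigma_finiteP[G [TG ndG Goo]] := sigma_finiteT mu.
pose u (t : n.+1.-tuple RR) := (thead t, [tuple of behead t]).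
have mu_ : measurable_fun setT u.
  apply/measurable_fun_pairP; split.
    exact: (measurable_tnth ord0).
  exact: measurable_behead.
exists (fun k => u @^-1` (F k `*` G k)).
  rewrite -preimage_bigcup predeqE => t; split=> // _.
  have [k _ Fk] : (\bigcup_k F k) (u t).1 by rewrite -TF.
  have [l _ Gl] : (\bigcup_k G k) (u t).2 by rewrite -TG.
  exists (maxn k l) => //; split.
    exact: (subsetPset _ _ (ndF _ _ (leq_maxl k l))).
  exact: (subsetPset _ _ (ndG _ _ (leq_maxr k l))).
move=> k; have [mF Fk] := Foo k; have [mG Gk] := Goo k; split.
  by rewrite -[X in measurable X]setTI; apply: mu_ => //; exact: measurableX.
rewrite /tuple_product /pushforward -comp_preimage.
rewrite (_ : u \o _ = id) ?preimage_id;
  first by rewrite product_measure1E// lte_mul_pinfty// ge0_fin_numE.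
apply/funext => -[a t] /=.
by congr pair => //; exact: val_inj.
Qed.

HB.instance Definition _ :=
  Measure_isSigmaFinite.Build _ _ _ tuple_product tuple_product_sigma_finite.

End tuple_product.

(* Lebesgue measure on R^n; for n = 0 it is the unit mass of the only point. *)
Fixpoint lebesgue_tuple n :
    {sigma_finite_measure set (n.-tuple RR) -> \bar R} :=
  if n is m.+1 then tuple_product (@lebesgue_measure R) (lebesgue_tuple m)
  else \d_([tuple] : 0.-tuple RR).
End lebesgue_tuple.

Section euclidean.
Context {R : realType} {d : nat}.
Local Notation E := 'rV[R]_d.

Definition dot (x y : E) : R := \sum_(j < d) x 0 j * y 0 j.

(* The library norm on row vectors is the sup norm; lengths, unit normals and
   diameters below are Euclidean. *)
Definition enorm (x : E) : R := Num.sqrt (dot x x).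

Definition diameter (A : set E) : R :=
  sup [set l | exists x y, [/\ A x, A y & l = enorm (x - y)]].

(* A polytope, not necessarily convex, is a bounded finite union of convex
   polyhedra, each of them a finite list of inequalities [dot a x <= b]. *)
Definition polytope (P : set E) : Prop :=
  bounded_set P /\
  exists s : seq (seq (E * R)),
    P = [set x | exists2 H, H \in s & forall ab, ab \in H -> dot ab.1 x <= ab.2].

(* The open set A coincides near x with the half-space through x whose outward
   unit normal is n. *)
Definition outward_normal (A : set E) (x n : E) : Prop :=
  enorm n = 1 /\
  exists2 delta : R, 0 < delta &
    forall y, enorm (y - x) < delta -> (A y <-> dot n (y - x) < 0).

Record flat_face := FlatFace {
  face_set :> set E;
  face_normal : E;
  face_offset : R;
}.

Definition face_plane (e : flat_face) : set E :=
  [set x | dot (face_normal e) x = face_offset e].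

(* interior of e relative to its hyperplane *)
Definition relint (e : flat_face) : set E :=
  [set x | face_set e x /\ exists2 delta : R, 0 < delta &
     forall y, face_plane e y -> enorm (y - x) < delta -> face_set e y].

(* The last condition says that e has dimension d - 1 at each of its points. *)
Definition is_flat_face (e : flat_face) : Prop :=
  [/\ enorm (face_normal e) = 1, face_set e `<=` face_plane e,
      polytope e, face_set e !=set0 & closure (relint e) = face_set e].

Definition of_tuple (t : d.-tuple R) : E := \row_j tnth t j.

Definition volume_integral (D : set E) (f : E -> R) : R :=
  \int[lebesgue_tuple d]_(t in [set t | D (of_tuple t)]) f (of_tuple t).

(* The point of the hyperplane of e whose coordinates other than the j-th one
   are listed by t; meaningful when the j-th component of the normal is not 0. *)
Definition graph_point (e : flat_face) (j : 'I_d) (t : (d.-1).-tuple R) : E :=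
  \row_k
    if unlift j k is Some l then tnth t l
    else (face_offset e - \sum_(l < d.-1) face_normal e 0 (lift j l) * tnth t l)
         / face_normal e 0 j.

(* Surface integral over e, seen as part of the graph of the affine function g
   expressing the j-th coordinate in terms of the others, for a j with n_j <> 0:
   ds = sqrt (1 + |grad g|^2) dt = |n_j|^-1 dt.  The value does not depend on
   the choice of j. *)
Definition face_integral (e : flat_face) (f : E -> R) : R :=
  if [pick j | face_normal e 0 j != 0] is Some j then
    `|face_normal e 0 j|^-1 *
    \int[lebesgue_tuple d.-1]_(t in [set t | face_set e (graph_point e j t)])
      f (graph_point e j t)
  else 0.

Definition bounded_domain (Omega : set E) : Prop :=
  [/\ open Omega, connected Omega, bounded_set Omega & Omega !=set0].

Definition frontier (A : set E) : set E := closure A `\` A°.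

(* Elements are open.  Two elements may share several faces, and a face may be a
   proper subset of the intersection of their boundaries: this covers hanging
   nodes and nonconvex elements, whose common boundary need not be flat. *)
Record mesh (Omega : set E) := Mesh {
  nelem : nat;
  elem : 'I_nelem -> set E;
  elem_nonempty : forall k, elem k !=set0;
  elem_regular_open : forall k, (closure (elem k))° = elem k;
  elem_polytope : forall k, polytope (closure (elem k));
  elem_disjoint : forall k l, k != l -> elem k `&` elem l = set0;
  elem_sub : forall k, elem k `<=` Omega;
  elem_cover : closure Omega = \bigcup_k closure (elem k);

  nif : nat;
  iface : 'I_nif -> flat_face;
  lo : 'I_nif -> 'I_nelem;
  hi : 'I_nif -> 'I_nelem;
  iface_flat : forall e, is_flat_face (iface e);
  lo_lt_hi : forall e, (lo e < hi e)%N;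
  iface_sub : forall e,
    iface e `<=` frontier (elem (lo e)) `&` frontier (elem (hi e));
  iface_inside : forall e, relint (iface e) `<=` Omega;
  iface_normal : forall e x, relint (iface e) x ->
    outward_normal (elem (lo e)) x (face_normal (iface e)) /\
    outward_normal (elem (hi e)) x (- face_normal (iface e));
  iface_disjoint : forall e e', e != e' ->
    relint (iface e) `&` relint (iface e') = set0;

  nbf : nat;
  bface : 'I_nbf -> flat_face;
  owner : 'I_nbf -> 'I_nelem;
  bface_flat : forall e, is_flat_face (bface e);
  bface_sub : forall e, bface e `<=` frontier (elem (owner e)) `&` frontier Omega;
  bface_normal : forall e x, relint (bface e) x ->
    outward_normal (elem (owner e)) x (face_normal (bface e)) /\
    outward_normal Omega x (face_normal (bface e));
  bface_disjoint : forall e e', e != e' ->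
    relint (bface e) `&` relint (bface e') = set0;

  faces_cover : forall k, frontier (elem k) =
    (\bigcup_(e in [set e | lo e = k \/ hi e = k]) iface e) `|`
    (\bigcup_(e in [set e | owner e = k]) bface e);
}.

Definition shape_regular Omega (Th : mesh Omega) (sigma : R) : Prop :=
  0 < sigma /\
  forall k : 'I_(nelem Th), exists x, forall y,
    enorm (y - x) < sigma * diameter (elem k) -> elem k y.

Definition locally_quasi_uniform Omega (Th : mesh Omega) (rho : R) : Prop :=
  0 < rho /\
  forall e : 'I_(nif Th),
    diameter (elem (lo e)) <= rho * diameter (elem (hi e)) /\
    diameter (elem (hi e)) <= rho * diameter (elem (lo e)).

Section polynomials.
Import -(notations) mpoly.

Definition poly_fun (r : nat) (f : E -> R) : Prop :=
  exists2 p : mpoly d R, (mmeasure mdeg p <= r.+1)%N &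
    f = fun x => meval (fun j => x 0 j) p.

End polynomials.

Variant sgn := Plus | Minus.

Definition opp_sgn (s : sgn) : sgn := if s is Plus then Minus else Plus.

Section broken.
Context {Omega : set E} {Th : mesh Omega}.

(* A piecewise function has one component per element.  Component k matters only
   on the closure of element k, and its trace on a face of element k is its
   restriction to that face. *)
Definition pw := 'I_(nelem Th) -> E -> R.

Definition Vh (r : nat) (v : pw) : Prop := forall k, poly_fun r (v k).

Definition inner (v w : pw) : R :=
  \sum_(k < nelem Th) volume_integral (elem k) (fun x => v k x * w k x).

Definition pw_partial (i : 'I_d) (v : pw) : pw :=
  fun k x => 'D_(delta_mx 0 i) (v k) x.

Definition jump (v : pw) (e : 'I_(nif Th)) (x : E) : R :=
  v (lo e) x - v (hi e) x.

Definition trace_Q (s : sgn) (i : 'I_d) (v : pw) (e : 'I_(nif Th)) (x : E) : R :=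
  match s with
  | Minus => if face_normal (iface e) 0 i < 0 then v (lo e) x else v (hi e) x
  | Plus => if face_normal (iface e) 0 i < 0 then v (hi e) x else v (lo e) x
  end.

Definition interior_pairing (f g : 'I_(nif Th) -> E -> R) : R :=
  \sum_(e < nif Th) face_integral (iface e) (fun x => f e x * g e x).

Definition boundary_pairing (f g : 'I_(nbf Th) -> E -> R) : R :=
  \sum_(e < nbf Th) face_integral (bface e) (fun x => f e x * g e x).

(* w is the discrete derivative of v with sign s in direction i.  On boundary
   faces both trace operators and the jump are the plain trace. *)
Definition is_discrete_derivative (r : nat) (s : sgn) (i : 'I_d)
    (gamma : 'I_(nif Th) -> R) (v w : pw) : Prop :=
  Vh r w /\
  forall phi : pw, Vh r phi ->
    inner w phi =
      (interior_pairing
         (fun e x => trace_Q s i v e x * face_normal (iface e) 0 i) (jump phi) +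
       boundary_pairing
         (fun e x => v (owner e) x * face_normal (bface e) 0 i)
         (fun e => phi (owner e)))
      - inner v (pw_partial i phi)
      + interior_pairing (fun e x => gamma e * jump v e x) (jump phi).

Definition central (dv : sgn -> pw) : pw :=
  fun k x => 2^-1 * (dv Minus k x + dv Plus k x).

(* <v, phi n^(i)> over the boundary faces *)
Definition boundary_term (i : 'I_d) (v phi : pw) : R :=
  boundary_pairing (fun e => v (owner e))
    (fun e x => phi (owner e) x * face_normal (bface e) 0 i).

End broken.
End euclidean.

Arguments pw {R d Omega} Th.

(* Main.v *)
Require Import Defs.
From mathcomp Require Import all_boot all_order all_algebra.
From mathcomp Require Import all_classical all_reals all_analysis.
From mathcomp Require Import measurable_realfun.
From mathcomp Require Import zify ring lra.
Import Order.TTheory GRing.Theory Num.Theory.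
Import numFieldNormedType.Exports.
Local Open Scope classical_set_scope.
Local Open Scope ring_scope.
Set Implicit Arguments.
Unset Strict Implicit.
Unset Printing Implicit Defensive.

(** Add the relation defining the discrete derivative of v with sign s, tested
    with phi, to the one defining the discrete derivative of phi with the
    opposite sign, tested with v.  The penalty terms cancel because gamma^+ and
    gamma^- are opposite.  On an interior face the trace of v and the trace of
    phi are taken from opposite sides, so that
      Q^s(v) [phi] + Q^(-s)(phi) [v] = [v phi].
    What is left ([one_sided_by_parts]) is Green's formula for piecewise
    polynomials ([green]),
      (v, d_i phi) + (phi, d_i v) = <[v phi], n_i> + <v phi, n_i>_boundary,
    that is, the divergence theorem on each element, applied to the polynomial
    v phi and summed over the elements.  The formula for the central derivative
    is the mean of the two one-sided formulas.

    The divergence theorem on a polytope K ([divergence_theorem]) is obtained by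
    integrating over the lines parallel to the i-th axis.
    - Fubini: Lebesgue measure on tuples may be disintegrated along any
      coordinate, not only the first one by which it is defined
      ([lebesgue_tuple_insert], [integral_tinsert]).
    - Almost every line in direction i meets a face only in its relative
      interior, and meets no face parallel to the line: the exceptional lines
      project into finitely many hyperplanes ([ae_transverse]).
    - On such a line, K cuts out a bounded open set that changes exactly at the
      crossed faces, from inside to outside or back according to the sign of
      n_i; the fundamental theorem of calculus turns the integral of d_i p over
      this set into a signed sum of values of p ([integral_deriv_slice]).
    - Integrating back over the lines gives integrals over the projections of
      the faces along axis i, whereas a face integral is defined by projection
      along the first admissible axis j.  Both agree because the two
      projections differ by an affine change of one variable, whose factor
      |n_j / n_i| is that of the surface densities 1 / |n_i| and 1 / |n_j|
      ([graph_measure_swap], [face_integralE]). *)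

(** * Lebesgue measure and integrals on the line *)

(** The form of [lebesgue_measure_itv] that rewrites whatever presentation of the
    set and of the sigma-algebra of the line occurs in the goal. *)
Lemma measure_itvE {R : realType} (i : interval R) (A : set (measurableTypeR R)) :
  A = [set` i] :> set R ->
  lebesgue_measure A = (if i.1 < i.2 then (i.2 : \bar R) - i.1 else 0)%E.
Proof. by move=> ->; exact: lebesgue_measure_itv. Qed.

(** Both sides are measures of A that agree on the intervals ]x, y]; an affine
    map with a < 0 reverses such an interval, which only moves the endpoint that
    is included. *)
Lemma lebesgue_measure_affine {R : realType} (a b : R) (A : set (measurableTypeR R)) :
  a != 0 -> measurable A ->
  lebesgue_measure A =
  (`|a|%:E * lebesgue_measure [set s : measurableTypeR R | A (a * s + b)%R])%E.
Proof.
move=> a0 mA.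
pose g (s : measurableTypeR R) : measurableTypeR R := a * s + b.
have mg : measurable_fun setT g.
  apply: measurable_funD => //; exact: measurable_funM.
pose mu := mscale (NngNum (normr_ge0 a))
  (measure_function_pushforward__canonical__measure_function_Measure
    (@lebesgue_measure R) mg).
have /= := @lebesgue_measure_unique R mu; rewrite /mu /mscale/= /pushforward => ->//.
move=> X [[x y] _ <-] /=.
have [xy|yx] := leP y x.
  by rewrite set_itv_ge ?measure0 ?mule0// bnd_simp -leNgt.
rewrite lebesgue_measure_itv /= lte_fin yx.
have [apos|aneg|] := ltgtP a 0; last by move/eqP; rewrite (negbTE a0).
- rewrite (@measure_itvE _ (`[(y - b) / a, (x - b) / a[)).
    rewrite /= lte_fin ltr_nM2r ?invr_lt0// ltrBlDr subrK yx.
    by rewrite ltr0_norm// -!EFinB -EFinM; congr EFin; field.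
  apply/seteqP; split => s /=; rewrite !in_itv /= /g.
    by move=> /andP[h1 h2]; rewrite ler_ndivrMr// ltr_ndivlMr//; lra.
  by move=> /andP[]; rewrite ler_ndivrMr// ltr_ndivlMr// => h1 h2; lra.
- rewrite (@measure_itvE _ (`](x - b) / a, (y - b) / a])).
    rewrite /= lte_fin ltr_pM2r ?invr_gt0// ltrBlDr subrK yx.
    by rewrite gtr0_norm// -!EFinB -EFinM; congr EFin; field.
  apply/seteqP; split => s /=; rewrite !in_itv /= /g.
    by move=> /andP[h1 h2]; rewrite ler_pdivlMr// ltr_pdivrMr//; lra.
  by move=> /andP[]; rewrite ler_pdivlMr// ltr_pdivrMr// => h1 h2; lra.
Qed.

(** The level set of g through x is open, closed and nonempty in the connected
    space R. *)
Lemma locally_constant_eq {R : realType} (T : eqType) (g : R -> T) :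
  (forall s, \forall u \near s, g u = g s) -> forall x y, g x = g y.
Proof.
move=> lc x y.
have cR : connected [set: R] by apply/connected_intervalP.
have h : [set s | g s = g x] = setT.
  apply: cR.
  - by exists x.
  - exists [set s | g s = g x]; last by rewrite setTI.
    rewrite openE => s /= gs; rewrite /interior.
    by apply: filterS (lc s) => u /= ->.
  - exists [set s | g s = g x]; last by rewrite setTI.
    move=> s cs /=; have [u [/= gu gus]] := cs _ (lc s).
    by rewrite -gus.
by have : [set s | g s = g x] y by rewrite h.
Qed.

Lemma Rintegral_sum {dd} {T : measurableType dd} {R : realType}
    (mu : {measure set T -> \bar R}) (D : set T) (I : Type) (s : seq I) (P : pred I)
    (F : I -> T -> R) :
  measurable D -> (forall a, P a -> mu.-integrable D (EFin \o F a)) ->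
  \int[mu]_(x in D) (\sum_(a <- s | P a) F a x) =
  \sum_(a <- s | P a) \int[mu]_(x in D) F a x.
Proof.
move=> mD iF; elim: s => [|a s IH].
  under eq_Rintegral do rewrite big_nil.
  by rewrite big_nil Rintegral_cst// mul0r.
rewrite big_cons -IH; case: ifPn => Pa; last first.
  by apply: eq_Rintegral => x _; rewrite big_cons (negbTE Pa).
rewrite -RintegralD//.
- by apply: eq_Rintegral => x _; rewrite big_cons Pa.
- exact: iF.
- rewrite (_ : EFin \o _ = (fun x => \sum_(i <- s | P i) (EFin \o F i) x)%E).
    exact: integrable_sum.
  by apply/funext => x /=; rewrite sumEFin.
Qed.

(** S stands for the trace of a polytope on a line, and the points [pos a] for
    the places where the line crosses its boundary, from S to its complement when
    [sg a = 1] and from the complement to S when [sg a = -1]. *)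
Section slices.
Context {R : realType} (I : finType) (B : pred I) (pos sg : I -> R) (S : set R).
Hypothesis S_bounded : exists M : R, forall s, S s -> `|s| < M.
Hypothesis S_off : forall s, (forall a, B a -> pos a != s) ->
  \forall u \near s, S u <-> S s.
Hypothesis sg_unit : forall a, B a -> sg a = 1 \/ sg a = -1.
Hypothesis S_at : forall a, B a ->
  \forall u \near pos a, S u <-> sg a * (u - pos a) < 0.
Hypothesis pos_inj : {in B &, injective pos}.

(** S does not contain [pos a].  A half-line that starts at an exit point must
   contain it, and one that starts at an entry point must not, for [jumps] below
   to be constant across these points. *)
Let up (a : I) : set R :=
  if 0 < sg a then `[pos a, +oo[%classic else `]pos a, +oo[%classic.

Let up_off a s : pos a != s -> \forall u \near s, \1_(up a) u = \1_(up a) s :> R.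
Proof.
move=> /eqP/eqP; rewrite neq_lt => /orP[h|h].
  near=> u; have hu : pos a < u by near: u; exact: lt_nbhsr.
  rewrite !indicE !mem_set// /up; case: ifP => _ /=; rewrite in_itv/= andbT//;
    exact/ltW.
near=> u; have hu : u < pos a by near: u; exact: lt_nbhsl.
rewrite !indicE !memNset// /up; case: ifP => _ /=; rewrite in_itv/= andbT;
  apply/negP; rewrite -?ltNge -?leNgt//; exact/ltW.
Unshelve. all: by end_near. Qed.

Let jumps (s : R) : R := \1_S s + \sum_(a | B a) sg a * \1_(up a) s.

Let S_pos a : B a -> ~ S (pos a).
Proof. by move=> Ba /(nbhs_singleton (S_at Ba)); rewrite subrr mulr0 ltxx. Qed.

Let jumps_lc s : \forall u \near s, jumps u = jumps s.
Proof.
have indS (u v : R) : (S u <-> S v) -> \1_S u = \1_S v :> R.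
  move=> h; rewrite !indicE; congr (nat_of_bool _)%:R.
  by apply/idP/idP; rewrite !inE => /h.
case: (pselect (exists2 a, B a & pos a = s)) => [[a Ba sa]|nB]; last first.
  have off a : B a -> pos a != s by move=> Ba; apply/eqP => e; apply: nB; exists a.
  near=> u.
  rewrite /jumps; congr (_ + _).
    apply: indS; near: u; exact: S_off.
  apply: eq_bigr => a Ba; congr (_ * _).
  move: (a) Ba; near: u.
  apply: filter_forall => b.
  case: (boolP (B b)) => Bb; last by apply: nearW.
  by apply: filterS (up_off (off _ Bb)).
near=> u.
(* Near s = pos a, only the step at [pos a] and the indicator of S vary, and their
   changes cancel. *)
rewrite /jumps [in LHS](bigD1 a)//= [in RHS](bigD1 a)//= 2!addrA; congr (_ + _);
  last first.
  apply: eq_bigr => b /andP[Bb ba]; congr (_ * _).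
  move: (b) Bb ba; near: u.
  apply: filter_forall => b.
  case: (boolP (B b)) => Bb; last by apply: nearW.
  case: (eqVneq b a) => ba; first by apply: nearW.
  have : pos b != s by rewrite -sa; apply: contra_neq ba; exact: pos_inj.
  by move/up_off; apply: filterS.
have hu : S u <-> sg a * (u - pos a) < 0 by near: u; rewrite -sa; exact: S_at.
have Ss : ~ S s by rewrite -sa; exact: S_pos.
have hup v : \1_(up a) v = (if 0 < sg a then (pos a <= v) else (pos a < v))%:R :> R.
  rewrite indicE /up; case: ifP => _; congr (nat_of_bool _)%:R; apply/idP/idP;
    rewrite !inE/= in_itv/= andbT//.
have hS : \1_S u = (sg a * (u - pos a) < 0)%R%:R :> R.
  by rewrite indicE; congr (nat_of_bool _)%:R; apply/idP/idP; rewrite inE => /hu.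
rewrite !hup hS -sa indicE (memNset (S_pos Ba)) lexx ltxx.
have [->|->] := sg_unit Ba.
  rewrite ltr01 !mul1r subr_lt0; case: ltgtP => _ /=; lra.
rewrite ltr0N1 !mulN1r oppr_lt0 subr_gt0; case: ltgtP => _ /=; lra.
Unshelve. all: by end_near. Qed.

Let bnd : exists M : R, [/\ 0 < M, forall s, S s -> `|s| < M & forall a, B a ->
  `|pos a| < M].
Proof.
have [M hM] := S_bounded.
exists (1 + `|M| + \sum_(a | B a) `|pos a|).
have h0 : 0 <= \sum_(a | B a) `|pos a| by apply: sumr_ge0.
split.
- by have := normr_ge0 M; lra.
- by move=> s /hM; have := ler_norm M; lra.
- move=> a Ba; rewrite (bigD1 a)//=.
  have : 0 <= \sum_(b | B b && (b != a)) `|pos b| by apply: sumr_ge0.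
  by have := normr_ge0 M; lra.
Qed.

Let jumps0 s : jumps s = 0.
Proof.
have [M [M0 hM hpos]] := bnd.
rewrite (locally_constant_eq jumps_lc s (- M)) /jumps indicE memNset; last first.
  by move/hM; rewrite normrN ltNge ler_norm.
rewrite add0r big1// => a Ba; rewrite indicE memNset ?mulr0//.
have := hpos _ Ba; rewrite ltr_norml => /andP[h _].
rewrite /up; case: ifP => _ /=; rewrite in_itv /= andbT; apply/negP;
  rewrite -?ltNge -?leNgt//; exact/ltW.
Qed.

(** Each side loses sg a at pos a.  Their difference, [jumps], is therefore
    locally constant, hence constant, and it vanishes far to the left, since S is
    bounded. *)
Lemma indic_slice s : \1_S s = - \sum_(a | B a) sg a * \1_(up a) s.
Proof. by apply/eqP; rewrite -addr_eq0; apply/eqP; exact: jumps0. Qed.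

Let sum_sg : \sum_(a | B a) sg a = 0.
Proof.
have [M [M0 hM hpos]] := bnd.
have := jumps0 M; rewrite /jumps indicE memNset; last first.
  by move/hM; rewrite ltNge ler_norm.
rewrite add0r => jM; rewrite -[RHS]jM; apply: eq_bigr => a Ba.
have := hpos _ Ba; rewrite ltr_norml => /andP[_ h].
by rewrite indicE mem_set ?mulr1// /up; case: ifP => _ /=; rewrite in_itv /= andbT//;
  exact/ltW.
Qed.

(** By [indic_slice] the integral is a combination of integrals of f' over the
    intervals from pos a to a common bound M, that is of f M - f (pos a).  The terms
    f M cancel because there are as many exits as entries: look at [indic_slice]
    to the right of S. *)
Lemma integral_deriv_slice (f f' : R -> R) :
  (forall s : R, is_derive s 1 f (f' s)) -> continuous f' ->
  \int[lebesgue_measure]_(s in S) f' s = \sum_(a | B a) sg a * f (pos a).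
Proof.
move=> df cf'.
have [M [M0 hM hpos]] := bnd.
pose J : set R := `[-M, M]%classic.
have SJ : S = J `&` S.
  apply/seteqP; split => [s Ss|s []//]; split => //; rewrite /J/= in_itv/=.
  by have := hM _ Ss; rewrite ltr_norml => /andP[/ltW-> /ltW->].
have iJ x : lebesgue_measure.-integrable `[x, M]%classic (EFin \o f').
  apply: continuous_compact_integrable; first exact: segment_compact.
  exact: continuous_subspaceT.
have mJ : measurable (J : set (measurableTypeR R)) by exact: measurable_itv.
have mup a : measurable (up a : set (measurableTypeR R)) by rewrite /up;
  case: ifP => _; exact: measurable_itv.
have Jup a : B a -> J `&` up a =
  if 0 < sg a then `[pos a, M]%classic else `]pos a, M]%classic.
  move=> Ba; have := hpos _ Ba; rewrite ltr_norml => /andP[h h'].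
  apply/seteqP; rewrite /J /up; split; case: ifP => _ s /=;
    rewrite !in_itv /= ?andbT; lra.
rewrite SJ Rintegral_mkcondr.
transitivity (\int[lebesgue_measure]_(s in J) \sum_(a | B a) - sg a * (f' \_ (up a)) s).
  apply: eq_Rintegral => s _; rewrite patchE.
  transitivity (f' s * \1_S s).
    by rewrite indicE; case: ifP => _; rewrite ?mulr1 ?mulr0.
  rewrite indic_slice -sumrN mulr_sumr; apply: eq_bigr => a _.
  by rewrite patchE indicE (_ : point = 0 :> R)//; case: ifP => _ /=; ring.
have iup a : lebesgue_measure.-integrable J (EFin \o (f' \_ (up a))).
  rewrite -restrict_EFin; apply/integrable_restrict => //.
  apply: (integrableS (E := J : set (measurableTypeR R))) => //;
    first exact: measurableI.
  exact: iJ.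
rewrite Rintegral_sum//; last first.
  move=> a _.
  rewrite (_ : _ \o _ = (fun x => (- sg a)%:E * (EFin \o (f' \_ (up a))) x)%E)//.
  exact: integrableZl.
transitivity (\sum_(a | B a) - sg a * (f M - f (pos a))).
  apply: eq_bigr => a Ba; rewrite RintegralZl//; congr (_ * _).
  rewrite -Rintegral_mkcondr Jup//.
  have := hpos _ Ba; rewrite ltr_norml => /andP[h h'].
  transitivity (\int[lebesgue_measure]_(x in `[pos a, M]) f' x).
    case: ifP => // _; apply: Rintegral_itv_obnd_cbnd.
    apply: (integrableS (E := `[pos a, M]%classic : set (measurableTypeR R))) => //.
    by apply: subset_itv; rewrite bnd_simp.
  have cf : continuous f.
    move=> s; apply: differentiable_continuous; apply/derivable1_diffP.
    by case: (df s).
  rewrite /Rintegral (continuous_FTC2 (F := f))//.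
  - exact: continuous_subspaceT.
  - split; first by move=> s _; case: (df s).
    + by apply: cvg_at_right_filter; exact: cf.
    + by apply: cvg_at_left_filter; exact: cf.
  - by move=> s _; rewrite derive1E; case: (df s).
under eq_bigr do rewrite mulrBr mulNr mulNr opprK.
by rewrite big_split/= sumrN -mulr_suml sum_sg mul0r oppr0 add0r.
Qed.

End slices.

(** * Lebesgue measure on tuples, disintegrated along any coordinate *)

Section tuples.
Context {R : realType}.
Local Notation RR := (measurableTypeR R).

Definition tinsert n (i : 'I_n.+1) (s : R) (t : n.-tuple R) : n.+1.-tuple R :=
  [tuple if unlift i k is Some l then tnth t l else s | k < n.+1].

Lemma tnth_tinsert_id n (i : 'I_n.+1) s (t : n.-tuple R) : tnth (tinsert i s t) i = s.
Proof. by rewrite tnth_mktuple unlift_none. Qed.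

Lemma tnth_tinsert_lift n (i : 'I_n.+1) s (t : n.-tuple R) l :
  tnth (tinsert i s t) (lift i l) = tnth t l.
Proof. by rewrite tnth_mktuple liftK. Qed.

Lemma tinsert_ord0 n s (t : n.-tuple R) : tinsert ord0 s t = tuple_cons (s, t).
Proof.
apply: eq_from_tnth => k; case: (unliftP ord0 k) => [l ->|->].
  by rewrite tnth_tinsert_lift tnthS.
by rewrite tnth_tinsert_id tnth0.
Qed.

Lemma tinsert_cons n (i : 'I_n.+1) s a (t : n.-tuple R) :
  tinsert (lift ord0 i) s (tuple_cons (a, t)) = tuple_cons (a, tinsert i s t).
Proof.
apply: eq_from_tnth => k; case: (unliftP ord0 k) => [l ->|->].
  rewrite tnthS; case: (unliftP i l) => [j ->|->].
    rewrite tnth_tinsert_lift (_ : lift ord0 (lift i j) =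
      lift (lift ord0 i) (lift ord0 j)).
      by rewrite tnth_tinsert_lift tnthS.
    by apply: val_inj; rewrite /= /bump /= add1n ltnS !add1n addnS.
  by rewrite !tnth_tinsert_id.
rewrite tnth0 (_ : ord0 = lift (lift ord0 i) ord0); last exact: val_inj.
by rewrite tnth_tinsert_lift tnth0.
Qed.

Lemma measurable_tinsert n (i : 'I_n.+1) :
  measurable_fun setT (fun p : RR * n.-tuple RR => tinsert i p.1 p.2 : n.+1.-tuple RR).
Proof.
apply/measurable_fun_tnthP => k /=; case: (unliftP i k) => [l ->|->].
  rewrite (_ : _ \o _ = (fun t => tnth t l) \o snd).
    by apply: measurableT_comp => //; exact: measurable_tnth.
  by apply/funext => p /=; rewrite tnth_tinsert_lift.
rewrite (_ : _ \o _ = fst)//.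
by apply/funext => p /=; rewrite tnth_tinsert_id.
Qed.

Lemma measurable_tinsert1 n (i : 'I_n.+1) (t : n.-tuple RR) :
  measurable_fun setT (fun s : RR => tinsert i s t : n.+1.-tuple RR).
Proof.
rewrite (_ : (fun _ => _) = (fun p => tinsert i p.1 p.2) \o (fun s => (s, t)))//.
by apply: measurableT_comp; [exact: measurable_tinsert|exact: measurable_pair2].
Qed.

Lemma lebesgue_tuple_cons n (A : set (n.+1.-tuple RR)) :
  lebesgue_tuple n.+1 A =
  (\int[lebesgue_measure]_a lebesgue_tuple n [set t | A (tuple_cons (a, t))])%E.
Proof.
rewrite /= /tuple_product/= /pushforward /product_measure1.
apply: eq_integral => a _ /=; congr (lebesgue_tuple n _).
by apply/seteqP; split => t /=; rewrite /xsection /= inE.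
Qed.

Lemma measurable_tinsert_preimage n (i : 'I_n.+1) (A : set (n.+1.-tuple RR)) :
  measurable A -> measurable [set p : RR * n.-tuple RR | A (tinsert i p.1 p.2)].
Proof. by move=> mA; rewrite -[X in measurable X]setTI; exact: measurable_tinsert. Qed.

Let ysectionE n (i : 'I_n.+1) (A : set (n.+1.-tuple RR)) t :
  ysection [set p : RR * n.-tuple RR | A (tinsert i p.1 p.2)] t =
    [set s : RR | A (tinsert i s t)].
Proof. by apply/seteqP; split => s /=; rewrite /ysection /= inE. Qed.

Lemma measurable_fun_tinsert_slice n (i : 'I_n.+1) (A : set (n.+1.-tuple RR)) :
  measurable A ->
  measurable_fun setT (fun t : n.-tuple RR =>
    lebesgue_measure [set s : RR | A (tinsert i s t)] : \bar R).
Proof.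
move=> /(measurable_tinsert_preimage i) mB.
have := measurable_fun_ysection (@lebesgue_measure R) mB.
by apply: eq_measurable_fun => t _ /=; rewrite ysectionE.
Qed.

(** The measure is defined by recursion on the first coordinate, so this is
    Tonelli's theorem when i is the first coordinate; otherwise split off the
    first coordinate on both sides and use induction. *)
Lemma lebesgue_tuple_insert n (i : 'I_n.+1) (A : set (n.+1.-tuple RR)) :
  measurable A ->
  lebesgue_tuple n.+1 A =
  (\int[lebesgue_tuple n]_t lebesgue_measure [set s : RR | A (tinsert i s t)])%E.
Proof.
have base m (B : set (m.+1.-tuple RR)) : measurable B -> lebesgue_tuple m.+1 B =
  (\int[lebesgue_tuple m]_t lebesgue_measure [set s : RR | B (tinsert ord0 s t)])%E.
  move=> mB; rewrite lebesgue_tuple_cons.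
  have mB' := measurable_tinsert_preimage ord0 mB.
  have := indic_fubini_tonelli (@lebesgue_measure R) (lebesgue_tuple m) mB'.
  rewrite indic_fubini_tonelli_FE// indic_fubini_tonelli_GE// => h.
  transitivity (\int[lebesgue_tuple m]_(t in setT) (lebesgue_measure \o
      ysection [set p | B (tinsert ord0 p.1 p.2)]) t)%E; last first.
    by apply: eq_integral => t _ /=; rewrite ysectionE.
  rewrite -h; apply: eq_integral => a _ /=; congr (lebesgue_tuple _ _).
  by apply/seteqP; split => t /=; rewrite /xsection /= inE /= tinsert_ord0.
elim: n => [|n IH] in i A *; first by rewrite (ord1 i); exact: base.
case: (unliftP ord0 i) => [k ->|->] mA; last exact: base.
rewrite lebesgue_tuple_cons.
have mg := measurable_fun_tinsert_slice (lift ord0 k) mA.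
rewrite [RHS](@ge0_integral_pushforward _ _ _ _ _ _ (measurable_tuple_cons (n := n))
  (@lebesgue_measure R \x lebesgue_tuple n)%E)//.
rewrite fubini_tonelli1//; last first.
  by apply: (measurableT_comp mg); exact: measurable_tuple_cons.
apply: eq_integral => a _; rewrite /fubini_F (IH k).
  apply: eq_integral => t _ /=; congr (lebesgue_measure _).
  by apply/seteqP; split => s /=; rewrite tinsert_cons.
rewrite -[X in measurable X]setTI.
suff : measurable_fun setT (fun t : n.+1.-tuple RR => tuple_cons (a, t)) by apply.
apply: measurableT_comp; first exact: measurable_tuple_cons.
exact: measurable_pair1.
Qed.

Lemma lebesgue_tuple_pushforward n (i : 'I_n.+1) (A : set (n.+1.-tuple RR)) :
  measurable A ->
  lebesgue_tuple n.+1 A =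
  pushforward (@lebesgue_measure R \x lebesgue_tuple n)%E
    (fun p : RR * n.-tuple RR => tinsert i p.1 p.2 : n.+1.-tuple RR) A.
Proof.
move=> mA; rewrite (lebesgue_tuple_insert i)// /pushforward.
have mB := measurable_tinsert_preimage i mA.
have := indic_fubini_tonelli (@lebesgue_measure R) (lebesgue_tuple n) mB.
rewrite indic_fubini_tonelli_FE// indic_fubini_tonelli_GE// => h.
by rewrite /product_measure1 h; apply: eq_integral => t _ /=; rewrite ysectionE.
Qed.

Lemma integrable_tinsert n (i : 'I_n.+1) (f : n.+1.-tuple RR -> \bar R) :
  (lebesgue_tuple n.+1).-integrable setT f ->
  (@lebesgue_measure R \x lebesgue_tuple n)%E.-integrable setT
    (fun p : RR * n.-tuple RR => f (tinsert i p.1 p.2)).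
Proof.
move=> /integrableP[mf foo]; have mphi := measurable_tinsert i.
apply/integrableP; split; first exact: measurableT_comp.
have := foo; rewrite (@eq_measure_integral _ _ _ _
  (measure_function_pushforward__canonical__measure_function_Measure
    (@lebesgue_measure R \x lebesgue_tuple n)%E mphi)).
  rewrite (@ge0_integral_pushforward _ _ _ _ _ _ mphi)//.
  exact: measurableT_comp.
by move=> A mA _; exact: lebesgue_tuple_pushforward.
Qed.

Lemma measurable_integral_tinsert n (i : 'I_n.+1) (f : n.+1.-tuple RR -> \bar R) :
  (lebesgue_tuple n.+1).-integrable setT f ->
  measurable_fun setT (fun t : n.-tuple RR =>
    \int[lebesgue_measure]_s f (tinsert i s t) : \bar R)%E.
Proof. by move/(integrable_tinsert i)/measurable_fubini_G. Qed.

Lemma integral_tinsert n (i : 'I_n.+1) (f : n.+1.-tuple RR -> \bar R) :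
  (lebesgue_tuple n.+1).-integrable setT f ->
  (\int[lebesgue_tuple n.+1]_x f x =
   \int[lebesgue_tuple n]_t \int[lebesgue_measure]_s f (tinsert i s t))%E.
Proof.
move=> intf; have intphi := integrable_tinsert i intf.
have mphi := measurable_tinsert i.
rewrite (@eq_measure_integral _ _ _ _
  (measure_function_pushforward__canonical__measure_function_Measure
    (@lebesgue_measure R \x lebesgue_tuple n)%E mphi)); last first.
  by move=> A mA _; exact: lebesgue_tuple_pushforward.
rewrite (integral_pushforward mphi)//; last by case/integrableP: intf.
by rewrite -integral21_prod_meas1.
Qed.

Definition hyperplane n (c : 'I_n -> R) (b : R) : set (n.-tuple R) :=
  [set t | \sum_l c l * tnth t l = b].

Lemma measurable_affine n (c : 'I_n -> R) :
  measurable_fun setT (fun t : n.-tuple RR => \sum_l c l * tnth t l : RR).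
Proof.
apply: measurable_sum => l; apply: measurable_funM => //.
exact: measurable_tnth.
Qed.

Lemma measurable_hyperplane n (c : 'I_n -> R) b :
  measurable (hyperplane c b : set (n.-tuple RR)).
Proof.
rewrite /hyperplane -[X in measurable X]setTI.
apply: (measurable_affine c _ (Y := [set b])) => //.
Qed.

(** Disintegrate along a coordinate l with c l != 0: every line in that
    direction meets the hyperplane in a single point. *)
Lemma hyperplane_null n (c : 'I_n -> R) b l : c l != 0 ->
  lebesgue_tuple n (hyperplane c b) = 0%E.
Proof.
case: n c l => [|n] c l; first by case: l.
move=> cl; rewrite (lebesgue_tuple_insert l); last exact: measurable_hyperplane.
apply: integral0_eq => t _.
rewrite (_ : [set s | _] = [set (b - \sum_k c (lift l k) * tnth t k) / c l]).
  by rewrite lebesgue_measure_set1.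
have sE s : \sum_k c k * tnth (tinsert l s t) k =
  c l * s + \sum_k c (lift l k) * tnth t k.
  rewrite (bigD1_ord l)//= tnth_tinsert_id; congr (_ + _).
  by apply: eq_bigr => k _; rewrite tnth_tinsert_lift.
apply/seteqP; split => s; rewrite /hyperplane /= sE.
  by move=> <-; field.
by move=> ->; field.
Qed.

End tuples.

Section box.
Context {R : realType}.
Local Notation RR := (measurableTypeR R).

Definition box n (M : R) : set (n.-tuple R) := [set t | forall j, `|tnth t j| <= M].

Lemma box_cons n M : (fun p => tuple_cons p) @^-1` (@box n.+1 M) =
  `[- M, M]%classic `*` @box n M.
Proof.
apply/seteqP; split => -[a t] /=; rewrite /box /= in_itv/= -ler_norml.
  move=> h; split; first by have := h ord0; rewrite tnth0.
  by move=> j; have := h (lift ord0 j); rewrite tnthS.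
move=> [ha ht] k; case: (unliftP ord0 k) => [j ->|->]; first by rewrite tnthS.
by rewrite tnth0.
Qed.

Lemma measurable_box n M : measurable (@box n M : set (n.-tuple RR)).
Proof.
rewrite (_ : box _ = \bigcap_(j in [set: 'I_n]) [set t | `|tnth t j| <= M]); last first.
  by apply/seteqP; split => t /= h j; [move=> _; exact: h|exact: (h j I)].
apply: fin_bigcap_measurable => //= j _.
rewrite (_ : [set t | _] = (@tnth _ RR ^~ j) @^-1` `[-M, M]%classic).
  by rewrite -[X in measurable X]setTI; apply: measurable_tnth => //;
    exact: measurable_itv.
by apply/seteqP; split => t /=; rewrite in_itv/= -ler_norml.
Qed.

Lemma box_lty n M : (lebesgue_tuple n (@box n M) < +oo)%E.
Proof.
elim: n => [|n IH].
  by rewrite /= diracE; case: (_ \in _); rewrite ltry.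
rewrite /= /tuple_product /pushforward box_cons product_measure1E//;
  last exact: measurable_box.
rewrite lte_mul_pinfty//.
by have /= := @measure_itvE R `[- M, M] _ erefl; rewrite /lebesgue_measure/= => ->;
  case: ifP => // _; rewrite -EFinB.
Qed.

End box.

(** * Polynomial functions *)

Section polynomials.
Context {R : realType} {d : nat}.
Local Notation E := 'rV[R]_d.
Local Notation RR := (measurableTypeR R).

(** Polynomial functions as the closure of constants and coordinates under sums
    and products: boundedness, measurability and differentiability then follow by
    induction, and derivatives stay in the class. *)
Inductive polynomial_fun : (E -> R) -> Prop :=
| polynomial_cst a : polynomial_fun (fun=> a)
| polynomial_coord j : polynomial_fun (fun x => x 0 j)
| polynomial_add f g : polynomial_fun f -> polynomial_fun g ->
    polynomial_fun (fun x => f x + g x)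
| polynomial_mul f g : polynomial_fun f -> polynomial_fun g ->
    polynomial_fun (fun x => f x * g x).

Lemma polynomial_sum (I : Type) (s : seq I) (P : pred I) (F : I -> E -> R) :
  (forall a, P a -> polynomial_fun (F a)) ->
  polynomial_fun (fun x => \sum_(a <- s | P a) F a x).
Proof.
move=> PF; elim: s => [|a s IH].
  by rewrite (_ : (fun _ => _) = fun=> 0); [exact: polynomial_cst|apply/funext => x;
    rewrite big_nil].
case: (boolP (P a)) => Pa; last first.
  by rewrite (_ : (fun _ => _) = fun x => \sum_(a <- s | P a) F a x)//;
    apply/funext => x; rewrite big_cons (negbTE Pa).
rewrite (_ : (fun _ => _) = fun x => F a x + \sum_(a <- s | P a) F a x).
  by apply: polynomial_add => //; exact: PF.
by apply/funext => x; rewrite big_cons Pa.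
Qed.

Lemma polynomial_prod (I : Type) (s : seq I) (F : I -> E -> R) :
  (forall a, polynomial_fun (F a)) ->
  polynomial_fun (fun x => \prod_(a <- s) F a x).
Proof.
move=> PF; elim: s => [|a s IH].
  by rewrite (_ : (fun _ => _) = fun=> 1); [exact: polynomial_cst|apply/funext => x;
    rewrite big_nil].
rewrite (_ : (fun _ => _) = fun x => F a x * \prod_(a <- s) F a x);
  first exact: polynomial_mul.
by apply/funext => x; rewrite big_cons.
Qed.

Lemma polynomial_exp f n : polynomial_fun f -> polynomial_fun (fun x => f x ^+ n).
Proof.
move=> Pf; elim: n => [|n IH]; first exact: polynomial_cst.
rewrite (_ : (fun _ => _) = fun x => f x * f x ^+ n); first exact: polynomial_mul.
by apply/funext => x; rewrite exprS.
Qed.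

Lemma poly_fun_polynomial r f : poly_fun r f -> polynomial_fun f.
Proof.
move=> [p _ ->]; rewrite /mpoly.meval /mpoly.mmap.
apply: polynomial_sum => m _; apply: polynomial_mul; first exact: polynomial_cst.
rewrite /mpoly.mmap1; apply: polynomial_prod => k; apply: polynomial_exp.
exact: polynomial_coord.
Qed.

Lemma polynomial_bounded f M : polynomial_fun f ->
  exists C, forall x : E, (forall j, `|x 0 j| <= M) -> `|f x| <= C.
Proof.
elim=> {f} [a|j|f g _ [C hC] _ [D hD]|f g _ [C hC] _ [D hD]].
- by exists `|a|.
- by exists M => x; exact.
- exists (C + D) => x hx; apply: le_trans (ler_normD _ _) _.
  by apply: lerD; [exact: hC|exact: hD].
- exists (C * D) => x hx; rewrite normrM.
  by apply: ler_pM => //; [exact: hC|exact: hD].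
Qed.

Lemma polynomial_measurable dd (T : measurableType dd) (X : T -> E) f :
  (forall j, measurable_fun [set: T] (fun t => X t 0 j : RR)) -> polynomial_fun f ->
  measurable_fun [set: T] (fun t => f (X t) : RR).
Proof.
move=> mX; elim=> {f} [a|j|f g _ mf _ mg|f g _ mf _ mg].
- exact: measurable_cst.
- exact: mX.
- exact: measurable_funD.
- exact: measurable_funM.
Qed.

Lemma is_derive_coord (i j : 'I_d) (x : E) :
  is_derive x (delta_mx 0 i : E) (fun y : E => y 0 j : R) (i == j)%:R.
Proof.
set q := (fun h : R =>
  h^-1 *: (((fun y : E => y 0 j : R) \o shift x) (h *: delta_mx 0 i) - x 0 j)).
have hq : q h @[h --> 0^'] --> ((i == j)%:R : R).
  apply: cvg_near_cst; near=> h; rewrite /q /= !mxE addrK eqxx/= eq_sym.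
  have h0 : h != 0 by near: h; exact: nbhs_dnbhs_neq.
  by rewrite /GRing.scale/= mulKf.
split; first by apply/cvg_ex; exists (i == j)%:R.
exact: cvg_lim.
Unshelve. all: by end_near. Qed.

Lemma polynomial_derive (i : 'I_d) f : polynomial_fun f ->
  exists2 g, polynomial_fun g & forall x, is_derive x (delta_mx 0 i : E) f (g x).
Proof.
elim=> {f} [a|j|f g Pf [f' Pf' df] Pg [g' Pg' dg]|f g Pf [f' Pf' df] Pg [g' Pg' dg]].
- by exists (fun=> 0); [exact: polynomial_cst|move=> x; exact: is_derive_cst].
- by exists (fun=> (i == j)%:R); [exact: polynomial_cst|move=> x;
    exact: is_derive_coord].
- exists (fun x => f' x + g' x); first exact: polynomial_add.
  by move=> x; exact: is_deriveD.
- exists (fun x => f x * g' x + g x * f' x).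
    by apply: polynomial_add; exact: polynomial_mul.
  by move=> x; exact: is_deriveM.
Qed.

End polynomials.

(** * Lines parallel to a coordinate axis *)

Section lines.
Context {R : realType} {n : nat}.
Local Notation E := 'rV[R]_n.+1.
Local Notation RR := (measurableTypeR R).

Definition line (i : 'I_n.+1) (t : n.-tuple R) (s : R) : E := of_tuple (tinsert i s t).

Lemma line_id i t s : line i t s 0 i = s.
Proof. by rewrite mxE tnth_tinsert_id. Qed.

Lemma line_lift i t s l : line i t s 0 (lift i l) = tnth t l.
Proof. by rewrite mxE tnth_tinsert_lift. Qed.

Lemma line_shift i t s h : line i t (h + s) = h *: delta_mx 0 i + line i t s.
Proof.
apply/rowP => k; case: (unliftP i k) => [l ->|->].
  by rewrite line_lift !mxE [lift i l == i]eq_sym (negbTE (neq_lift _ _))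
    /= mulr0 add0r tnth_tinsert_lift.
by rewrite line_id !mxE !eqxx tnth_tinsert_id mulr1.
Qed.

Lemma is_derive_line (i : 'I_n.+1) t s (f : E -> R) (df : R) :
  is_derive (line i t s) (delta_mx 0 i : E) f df -> is_derive s 1 (f \o line i t) df.
Proof.
move=> [dv dval].
have e :
    (fun h : R => h^-1 *: ((f \o line i t \o shift s) (h *: 1) - (f \o line i t) s)) =
    (fun h : R =>
       h^-1 *: ((f \o shift (line i t s)) (h *: delta_mx 0 i) - f (line i t s))).
  by apply/funext => h /=; rewrite /GRing.scale /= mulr1 line_shift.
by split; [rewrite /derivable e|rewrite /derive e].
Qed.

Lemma polynomial_line_continuous i t (f : E -> R) : polynomial_fun f ->
  continuous (f \o line i t).
Proof.
move=> /(polynomial_derive i)[g _ df] s.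
apply: differentiable_continuous; apply/derivable1_diffP.
by case: (is_derive_line (df (line i t s))).
Qed.

Lemma line_continuous i t : continuous (line i t).
Proof.
move=> s; rewrite (_ : line i t = fun u => (u - s) *: delta_mx 0 i + line i t s);
  last first.
  by apply/funext => u; rewrite -line_shift subrK.
apply: cvgD; last exact: cvg_cst.
apply: cvgZr_tmp; apply: cvgB; [exact: cvg_id|exact: cvg_cst].
Qed.

Lemma line_near i t s (A : set E) : nbhs (line i t s) A ->
  \forall u \near s, A (line i t u).
Proof. by move=> nA; have := @line_continuous i t s; apply. Qed.

Lemma line_enorm i t s u : enorm (line i t u - line i t s) = `|u - s|.
Proof.
rewrite -{1}(subrK s u) line_shift addrK /enorm /dot (bigD1_ord i)//= big1 ?addr0;
  last first.
  by move=> l _; rewrite !mxE [lift i l == i]eq_sym (negbTE (neq_lift _ _)) /= !mulr0.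
by rewrite !mxE !eqxx /= mulr1 -expr2 sqrtr_sqr.
Qed.

End lines.

(** * Polytopes *)

Section polytopes.
Context {R : realType} {d : nat}.
Local Notation E := 'rV[R]_d.
Local Notation RR := (measurableTypeR R).

Lemma polytope_measurable dd (T : measurableType dd) (X : T -> E) (P : set E) :
  (forall j, measurable_fun [set: T] (fun t => X t 0 j : RR)) -> polytope P ->
  measurable [set t | P (X t)].
Proof.
move=> mX [_ [s ->]].
have mdot a b : measurable [set t | dot a (X t) <= b].
  have mf : measurable_fun [set: T] (fun t => dot a (X t) : RR).
    by rewrite /dot; apply: measurable_sum => j; apply: measurable_funM;
      [exact: measurable_cst|exact: mX].
  rewrite (_ : [set t | _] = (fun t => dot a (X t)) @^-1` `]-oo, b]%classic).
    by rewrite -[X in measurable X]setTI; apply: mf => //; exact: measurable_itv.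
  by apply/seteqP; split => t /=; rewrite in_itv.
have mH (H : seq (E * R)) : measurable [set t | forall ab, ab \in H ->
  dot ab.1 (X t) <= ab.2].
  elim: H => [|ab H IH].
    by rewrite (_ : [set t | _] = setT)//; apply/seteqP; split.
  rewrite (_ : [set t | _] = [set t | dot ab.1 (X t) <= ab.2] `&`
      [set t | forall ab, ab \in H -> dot ab.1 (X t) <= ab.2]);
        first exact: measurableI.
  apply/seteqP; split => t /=.
    move=> h; split; first by apply: h; rewrite mem_head.
    by move=> ab' H'; apply: h; rewrite in_cons H' orbT.
  by move=> [h1 h2] ab'; rewrite in_cons => /predU1P[->//|/h2].
elim: s => [|H s IH].
  by rewrite (_ : [set t | _] = set0)//; apply/seteqP; split => t //= -[].
rewrite (_ : [set t | _] = [set t | forall ab, ab \in H -> dot ab.1 (X t) <= ab.2] `|`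
  [set t | [set x | exists2 H, H \in s & forall ab, ab \in H ->
    dot ab.1 x <= ab.2] (X t)]).
  exact: measurableU.
apply/seteqP; split => t /=.
  move=> [H']; rewrite in_cons => /predU1P[->|H's] h; first by left.
  by right; exists H'.
move=> [h|[H' H's h]]; first by exists H => //; rewrite mem_head.
by exists H' => //; rewrite in_cons H's orbT.
Qed.

Lemma polytope_bounded (P : set E) : polytope P ->
  exists M, forall x, P x -> forall j, `|x 0 j| <= M.
Proof.
move=> [[M [_ hM]] _]; exists (M + 1) => x Px j.
apply: le_trans (hM (M + 1) _ x Px); last by rewrite ltrDl.
rewrite /Num.norm/= mx_normrE.
by apply: (le_bigmax_cond _ (fun ij : ('I_1 * 'I_d)%type =>
  `|x ij.1 ij.2|) (j := (0, j))).
Qed.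

Lemma coord_le_enorm (x : E) j : `|x 0 j| <= enorm x.
Proof.
rewrite /enorm -sqrtr_sqr ler_sqrt; last by apply: sumr_ge0 => k _;
  rewrite -expr2 sqr_ge0.
rewrite /dot (bigD1 j)//= -expr2 lerDl.
by apply: sumr_ge0 => k _; rewrite -expr2 sqr_ge0.
Qed.

Lemma dot_le_enorm (a x : E) : `|dot a x| <= (\sum_j `|a 0 j|) * enorm x.
Proof.
rewrite mulr_suml; apply: le_trans (ler_norm_sum _ _ _) _.
by apply: ler_sum => j _; rewrite normrM ler_wpM2l// coord_le_enorm.
Qed.

Lemma dotB (a x y : E) : dot a (x - y) = dot a x - dot a y.
Proof. by rewrite /dot -sumrB; apply: eq_bigr => j _; rewrite !mxE mulrBr. Qed.

(** Covers the integrals over elements (X lists all the coordinates) and over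
    faces (X parametrizes a hyperplane).  The second hypothesis makes the parameters
    of a bounded set D bounded, so that their set has finite measure. *)
Lemma polynomial_integrable n (X : n.-tuple RR -> E) (D : set E) M (f : E -> R) :
  (forall j, measurable_fun [set: n.-tuple RR] (fun t => X t 0 j : RR)) ->
  (forall t l, exists k, tnth t l = X t 0 k) ->
  measurable [set t | D (X t)] ->
  (forall x, D x -> forall j, `|x 0 j| <= M) ->
  polynomial_fun f ->
  (lebesgue_tuple n).-integrable [set t | D (X t)] (EFin \o (fun t => f (X t))).
Proof.
move=> mX Xcoord mD DM Pf.
apply: measurable_bounded_integrable => //.
- apply: (@le_lt_trans _ _ (lebesgue_tuple n (@box R n M))); last exact: box_lty.
  apply: le_measure; rewrite ?inE//; first exact: measurable_box.
  by move=> t /= Dt l; have [k ->] := Xcoord t l; exact: DM.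
- by apply: measurable_funTS; exact: polynomial_measurable.
- have [C hC] := polynomial_bounded M Pf.
  exists C; split; first exact: num_real.
  move=> C' /ltW CC' t /= Dt; apply: le_trans CC'; apply: hC; exact: DM.
Qed.

End polytopes.

(** * Flat faces and the lines that cross them *)

Lemma ae_all_seq dd (T : measurableType dd) (R : realType) (mu : {measure set T ->
  \bar R})
    (U : eqType) (s : seq U) (P : U -> T -> Prop) :
  (forall x, x \in s -> {ae mu, forall t, P x t}) ->
  {ae mu, forall t, forall x, x \in s -> P x t}.
Proof.
elim: s => [|x s IH] h; first exact: aeW.
have hx := h x (mem_head _ _).
have hs : {ae mu, forall t, forall x, x \in s -> P x t}.
  by apply: IH => y ys; apply: h; rewrite in_cons ys orbT.
near=> t => y; rewrite in_cons => /predU1P[->|]; first by near: t.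
by move: y; near: t.
Unshelve. all: by end_near. Qed.

Section faces.
Context {R : realType} {n : nat}.
Local Notation E := 'rV[R]_n.+1.
Local Notation RR := (measurableTypeR R).
Implicit Types (e : @flat_face R n.+1) (i : 'I_n.+1) (t : n.-tuple RR).

Lemma dot_line (a : E) i t s :
  dot a (line i t s) = a 0 i * s + \sum_l a 0 (lift i l) * tnth t l.
Proof.
rewrite /dot (bigD1_ord i)//= line_id; congr (_ + _).
by apply: eq_bigr => l _; rewrite line_lift.
Qed.

(** The i-th coordinate at which the line over t meets the hyperplane of e, when
    n_i != 0. *)
Definition height e i t : R :=
  (face_offset e - \sum_l face_normal e 0 (lift i l) * tnth t l) / face_normal e 0 i.

Lemma graph_pointE e i t : graph_point e i t = line i t (height e i t).
Proof. by apply/rowP => k; rewrite !mxE tnth_mktuple. Qed.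

Lemma face_plane_line e i t s : face_normal e 0 i != 0 ->
  face_plane e (line i t s) <-> s = height e i t.
Proof.
move=> ni; rewrite /face_plane /= dot_line /height; split; first by move=> <-; field.
by move=> ->; field.
Qed.

Lemma face_line e i t s : is_flat_face e -> face_normal e 0 i != 0 ->
  face_set e (line i t s) <-> s = height e i t /\ face_set e (graph_point e i t).
Proof.
move=> [_ sub _ _ _] ni; rewrite graph_pointE; split; last by move=> [->].
move=> h; have := sub _ h; rewrite (face_plane_line _ _ ni) => <-.
by split.
Qed.

Lemma face_normal_neq0 e : is_flat_face e -> exists k, face_normal e 0 k != 0.
Proof.
move=> [e1 _ _ _ _]; apply/existsP; rewrite -negb_forall; apply/forallP => h.
move: e1; rewrite /enorm /dot big1 ?sqrtr0; first by move/eqP; rewrite eq_sym oner_eq0.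
by move=> k _; rewrite (eqP (h k)) mul0r.
Qed.

Lemma ae_notin_hyperplane (c : 'I_n -> R) b l : c l != 0 ->
  {ae lebesgue_tuple n, forall t, ~ hyperplane c b t}.
Proof.
move=> cl; exists (hyperplane c b); split.
- exact: measurable_hyperplane.
- exact: hyperplane_null cl.
- by move=> t /= /contrapT.
Qed.

Lemma line_of_row i (y : E) : y = line i [tuple y 0 (lift i l) | l < n] (y 0 i).
Proof.
apply/rowP => k; case: (unliftP i k) => [l ->|->]; last by rewrite line_id.
by rewrite line_lift tnth_mktuple.
Qed.

(** If n_i = 0, a line that meets the hyperplane of e lies in it, and t is then
    on a hyperplane of R^n.  Otherwise, write each inequality a.x <= b that
    describes e in the coordinates t of the hyperplane of e.  It is either
    independent of t, hence true everywhere on the hyperplane or nowhere, or an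
    equality only for t on a hyperplane of R^n.  Outside these finitely many null
    sets, the inequalities satisfied at the point of e over t that depend on t are
    strict, and remain true nearby. *)
Lemma ae_transverse e i : is_flat_face e ->
  {ae lebesgue_tuple n, forall t, forall s, face_set e (line i t s) ->
    face_normal e 0 i != 0 /\ relint e (line i t s)}.
Proof.
move=> fe; have [_ sub [_ [sH eE]] _ _] := fe.
have [ni|ni] := eqVneq (face_normal e 0 i) 0.
  have [k] := face_normal_neq0 fe.
  case: (unliftP i k) => [l ->|->]; last by rewrite ni eqxx.
  move=> /(@ae_notin_hyperplane (fun l => face_normal e 0 (lift i l)) (face_offset e)).
  apply: filterS => t ht s /sub; rewrite /face_plane /= dot_line ni mul0r add0r.
  by move/ht.
(* On the hyperplane of e, the linear form a reads c a in the coordinates t, up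
   to a constant: solve for the i-th coordinate. *)
pose c (a : E) l := a 0 (lift i l) - a 0 i * face_normal e 0 (lift i l)
  / face_normal e 0 i.
pose b' (ab : E * R) := ab.2 - ab.1 0 i * face_offset e / face_normal e 0 i.
have dotE (a : E) t : dot a (line i t (height e i t)) =
    \sum_l c a l * tnth t l + a 0 i * face_offset e / face_normal e 0 i.
  rewrite dot_line /height.
  transitivity (\sum_l a 0 (lift i l) * tnth t l -
    (a 0 i / face_normal e 0 i) * (\sum_l face_normal e 0 (lift i l) * tnth t l)
    + a 0 i * face_offset e / face_normal e 0 i); first by field.
  congr (_ + _); rewrite mulr_sumr -sumrB; apply: eq_bigr => l _.
  by rewrite /c; field.
have good : {ae lebesgue_tuple n, forall t, forall ab, ab \in flatten sH ->
    (exists l, c ab.1 l != 0) -> ~ hyperplane (c ab.1) (b' ab) t}.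
  apply: ae_all_seq => ab _.
  have [[l cl]|nc] := pselect (exists l, c ab.1 l != 0); last exact: aeW.
  by have := ae_notin_hyperplane (b' ab) cl; apply: filterS => t ht _.
apply: filterS good => t good s es; split=> //; split=> //.
have hs := (face_plane_line t s ni).1 (sub _ es).
have := es; rewrite eE => -[H HsH xH].
suff [delta d0 hd] : exists2 delta : R, 0 < delta & forall y, face_plane e y ->
    enorm (y - line i t s) < delta -> forall ab, ab \in H -> dot ab.1 y <= ab.2.
  by exists delta => // y py yd; exists H => //; exact: hd py yd.
have one ab : ab \in H -> exists2 delta : R, 0 < delta & forall y, face_plane e y ->
    enorm (y - line i t s) < delta -> dot ab.1 y <= ab.2.
  move=> abH; have xab := xH _ abH.
  have [cl|nc] := pselect (exists l, c ab.1 l != 0); last first.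
    exists 1 => // y; rewrite (line_of_row i y) => /(face_plane_line _ _ ni) ->.
    move=> _; apply: le_trans xab; rewrite hs !dotE.
    rewrite lerD2r !big1// => l _.
      by have [->|h] := eqVneq (c ab.1 l) 0; [rewrite mul0r|case: nc; exists l].
    by have [->|h] := eqVneq (c ab.1 l) 0; [rewrite mul0r|case: nc; exists l].
  have lt : dot ab.1 (line i t s) < ab.2.
    rewrite lt_neqAle xab andbT; apply/eqP => h.
    apply: (good ab _ cl); first by apply/flattenP; exists H.
    by rewrite /hyperplane /b' /= -h hs dotE addrK.
  pose m := \sum_j `|ab.1 0 j| + 1.
  have m0 : 0 < m by rewrite ltr_wpDl// sumr_ge0.
  exists ((ab.2 - dot ab.1 (line i t s)) / m); first by rewrite divr_gt0// subr_gt0.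
  move=> y _; rewrite ltr_pdivlMr// => h.
  have := dot_le_enorm ab.1 (y - line i t s); rewrite dotB.
  have e0 : 0 <= enorm (y - line i t s) by rewrite sqrtr_ge0.
  have := ler_norm (dot ab.1 y - dot ab.1 (line i t s)).
  rewrite /m mulrDr mulr1 [enorm _ * _]mulrC in h.
  lra.
elim: H {HsH xH} one => [|ab H IH] one; first by exists 1.
have [|d1 d10 h1] := IH; first by move=> ab' h; apply: one; rewrite in_cons h orbT.
have [d2 d20 h2] := one ab (mem_head _ _).
exists (Num.min d1 d2); first by rewrite lt_min d10.
move=> y py; rewrite lt_min => /andP[y1 y2] ab'; rewrite in_cons => /predU1P[->|].
  exact: h2.
exact: h1.
Qed.

End faces.

(** * Surface integrals do not depend on the axis of projection *)

Lemma integral_mscale dd (T : measurableType dd) (R : realType)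
    (k : {nonneg R}) (mu : {measure set T -> \bar R}) (D : set T) (f : T -> \bar R) :
  measurable D -> mu.-integrable D f ->
  (\int[mscale k mu]_(x in D) f x = k%:num%:E * \int[mu]_(x in D) f x)%E.
Proof.
move=> mD intf; have [mf _] := integrableP _ _ _ intf.
rewrite [LHS]integralE [X in _ = (_ * X)%E]integralE !ge0_integral_mscale//; first last.
- exact: measurable_funepos.
- exact: measurable_funeneg.
rewrite [RHS]muleBr// fin_num_adde_defr//.
exact: integrable_pos_fin_num.
Qed.

Section face_integrals.
Context {R : realType} {n : nat}.
Local Notation E := 'rV[R]_n.+1.
Local Notation RR := (measurableTypeR R).
Implicit Types (e : @flat_face R n.+1) (i : 'I_n.+1) (t : n.-tuple RR).

(** [graph_point] with values in tuples, where the sigma-algebra lives. *)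
Definition graph_tuple e i t : n.+1.-tuple RR := tinsert i (height e i t) t.

Lemma measurable_graph_tuple e i : measurable_fun setT (graph_tuple e i).
Proof.
have mh : measurable_fun setT (fun t : n.-tuple RR => height e i t : RR).
  apply: measurable_funM; last exact: measurable_cst.
  by apply: measurable_funB; [exact: measurable_cst|exact: measurable_affine].
apply: (measurableT_comp (measurable_tinsert i) (g := fun t => (height e i t : RR, t))).
by apply/measurable_fun_pairP; split; [exact: mh|exact: measurable_id].
Qed.

Lemma measurable_of_tuple_coord (j : 'I_n.+1) :
  measurable_fun setT (fun t : n.+1.-tuple RR => of_tuple t 0 j : RR).
Proof.
rewrite (_ : (fun _ => _) = (@tnth _ RR ^~ j)); first exact: measurable_tnth.
by apply/funext => t; rewrite mxE.
Qed.

Lemma graph_tupleE e i t : graph_point e i t = of_tuple (graph_tuple e i t).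
Proof. exact: graph_pointE. Qed.

Lemma measurable_graph_point e i (j : 'I_n.+1) :
  measurable_fun setT (fun t : n.-tuple RR => graph_point e i t 0 j : RR).
Proof.
rewrite (_ : (fun _ => _) = (fun t : n.+1.-tuple RR =>
  of_tuple t 0 j : RR) \o graph_tuple e i).
  by apply: measurableT_comp;
    [exact: measurable_of_tuple_coord|exact: measurable_graph_tuple].
by apply/funext => t /=; rewrite graph_tupleE.
Qed.

Lemma face_measurable e i : is_flat_face e ->
  measurable [set t : n.-tuple RR | face_set e (graph_point e i t)].
Proof.
by move=> [_ _ pe _ _]; apply: polytope_measurable => // j;
  exact: measurable_graph_point.
Qed.

Lemma face_integrable e i (f : E -> R) : is_flat_face e -> polynomial_fun f ->
  (lebesgue_tuple n).-integrable [set t | face_set e (graph_point e i t)]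
    (EFin \o (fun t => f (graph_point e i t))).
Proof.
move=> fe Pf; have [_ _ pe _ _] := fe; have [M hM] := polytope_bounded pe.
apply: (@polynomial_integrable _ _ _ _ (face_set e) M) => //.
- by move=> j; exact: measurable_graph_point.
- by move=> t l; exists (lift i l); rewrite graph_pointE line_lift.
- exact: face_measurable.
Qed.

End face_integrals.

(** The coordinates other than the i-th and the j-th are enumerated in the same
    order whichever of the two is removed first. *)
Lemma bump_swap a b a' b' c : b = bump a b' -> a = bump b a' ->
  bump a (bump b' c) = bump b (bump a' c).
Proof.
move=> bE aE; rewrite bumpC -bE; congr (bump b (bump _ c)).
move: bE aE; rewrite /bump /unbump.
by case: (leqP a b') => h1; case: (leqP b a') => h2 /=; lia.
Qed.

Section independence.
Context {R : realType}.
Local Notation RR := (measurableTypeR R).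

(** Both tuples are the point of the hyperplane of e with i-th coordinate
    [height e i _] and with coordinates u away from i and j; since n_j != 0, such a
    point is unique. *)
Lemma graph_tuple_swap m (e : @flat_face R m.+2) (i j : 'I_m.+2) (i' j' : 'I_m.+1)
    (s : R) (u : m.-tuple RR) :
  j = lift i j' -> i = lift j i' ->
  face_normal e 0 i != 0 -> face_normal e 0 j != 0 ->
  graph_tuple e i (tinsert j' s u) =
  graph_tuple e j (tinsert i' (height e i (tinsert j' s u)) u).
Proof.
move=> jE iE ni nj.
have liftE l : lift i (lift j' l) = lift j (lift i' l).
  apply: val_inj; have /= jE' := congr1 val jE; have /= iE' := congr1 val iE.
  exact: bump_swap.
pose t := tinsert j' s u : m.+1.-tuple RR.
have coord (x : m.+2.-tuple R) : face_plane e (of_tuple x) ->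
    tnth x i = height e i t -> (forall l, tnth x (lift i (lift j' l)) = tnth u l) ->
    x = graph_tuple e i t.
  move=> px xi xu; apply: eq_from_tnth => k; rewrite /graph_tuple.
  case: (unliftP i k) => [k' ->|->]; last by rewrite xi tnth_tinsert_id.
  rewrite tnth_tinsert_lift.
  case: (unliftP j' k') => [l ->|->]; first by rewrite xu tnth_tinsert_lift.
  have pt : face_plane e (of_tuple (graph_tuple e i t)).
    by apply/(face_plane_line _ _ ni).
  have sumE (y : m.+2.-tuple R) : dot (face_normal e) (of_tuple y) =
      face_normal e 0 i * tnth y i + (face_normal e 0 j * tnth y j +
        \sum_l face_normal e 0 (lift i (lift j' l)) * tnth y (lift i (lift j' l))).
    rewrite /dot (bigD1_ord i)//= mxE; congr (_ + _); rewrite (bigD1_ord j')//= mxE -jE.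
    by congr (_ + _); apply: eq_bigr => l _; rewrite mxE.
  have : tnth x j = tnth (graph_tuple e i t) j.
    apply: (mulfI nj); apply: (addIr (\sum_l face_normal e 0 (lift i (lift j' l))
      * tnth u l)).
    apply: (addrI (face_normal e 0 i * height e i t)).
    move: px pt; rewrite /face_plane /= !sumE xi /graph_tuple tnth_tinsert_id.
    rewrite (eq_bigr _ (fun l _ => congr1 _ (xu l))) => -> <-.
    congr (_ + (_ + _)); apply: eq_bigr => l _.
    by rewrite !tnth_tinsert_lift.
  by rewrite /graph_tuple {1 2}jE !tnth_tinsert_lift.
symmetry; apply: coord.
- by apply/(face_plane_line _ _ nj).
- by rewrite /graph_tuple [X in tnth _ X = _]iE tnth_tinsert_lift tnth_tinsert_id.
- by move=> l; rewrite liftE /graph_tuple !tnth_tinsert_lift.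
Qed.

(** Disintegrate each side so that u, the coordinates other than the i-th and
    the j-th, is integrated last.  For fixed u, the i-th coordinate of a point of the
    hyperplane of e is an affine function of the j-th one, with slope
    a = - n_j / n_i, so the measures of the two slices differ by the factor |a|. *)
Lemma graph_measure_swap n (e : @flat_face R n.+1) (i j : 'I_n.+1)
  (A : set (n.+1.-tuple RR)) :
  measurable A -> face_normal e 0 i != 0 -> face_normal e 0 j != 0 ->
  (`|face_normal e 0 i|^-1%:E * lebesgue_tuple n [set t | A (graph_tuple e i t)] =
   `|face_normal e 0 j|^-1%:E * lebesgue_tuple n [set t | A (graph_tuple e j t)])%E.
Proof.
move=> mA ni nj; have [->//|ij] := eqVneq i j.
case: n => [|m] in e i j A mA ni nj ij *.
  by move: ij; rewrite (ord1 i) (ord1 j) eqxx.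
have [j' jE] : exists j' : 'I_m.+1, j = lift i j'.
  by case: (unliftP i j) ij => [j' -> _|->]; [exists j'|rewrite eqxx].
have [i' iE] : exists i' : 'I_m.+1, i = lift j i'.
  by case: (unliftP j i) ij => [i' -> _|->]; [exists i'|rewrite eqxx].
have mB k : measurable [set t : m.+1.-tuple RR | A (graph_tuple e k t)].
  by rewrite -[X in measurable X]setTI; exact: measurable_graph_tuple.
rewrite (lebesgue_tuple_insert j' (mB i)) (lebesgue_tuple_insert i' (mB j)).
set a := - face_normal e 0 j / face_normal e 0 i.
have a0 : a != 0 by rewrite mulf_neq0 ?oppr_eq0 ?invr_neq0.
have slice u : lebesgue_measure [set s : RR | A (graph_tuple e j (tinsert i' s u))] =
    (`|a|%:E * lebesgue_measure [set s : RR | A (graph_tuple e i (tinsert j' s u))])%E.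
  pose b := height e i (tinsert j' 0 u).
  have hE s : height e i (tinsert j' s u) = a * s + b.
    rewrite /b /height /= (bigD1_ord j')//= (bigD1_ord j')//= !tnth_tinsert_id -jE /a.
    under eq_bigr do rewrite tnth_tinsert_lift.
    under [X in _ = _ + (_ - (_ + X)) / _]eq_bigr do rewrite tnth_tinsert_lift.
    by field.
  rewrite (@lebesgue_measure_affine R a b)//; last first.
    rewrite -[X in measurable X]setTI.
    by apply: (measurableT_comp (measurable_graph_tuple e j)
      (measurable_tinsert1 i' u)).
  congr (_ * lebesgue_measure _)%E; apply/seteqP; split => s /=.
    by rewrite -hE -graph_tuple_swap.
  by rewrite (graph_tuple_swap _ _ jE iE)// hE.
under [in RHS]eq_integral do rewrite slice.
rewrite ge0_integralZl//; last exact: (measurable_fun_tinsert_slice j' (mB i)).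
rewrite muleA -EFinM; congr (_%:E * _)%E.
by rewrite /a normrM normrN normfV mulrA mulVf ?mul1r// normr_eq0.
Qed.

Lemma face_integralE n (e : @flat_face R n.+1) (i : 'I_n.+1) (f : 'rV[R]_n.+1 -> R) :
  is_flat_face e -> face_normal e 0 i != 0 -> polynomial_fun f ->
  face_integral e f = `|face_normal e 0 i|^-1 *
    \int[lebesgue_tuple n]_(t in [set t | face_set e (graph_point e i t)])
      f (graph_point e i t).
Proof.
move=> fe ni Pf; rewrite /face_integral; case: pickP => [j nj|]; last first.
  by move=> /(_ i); rewrite ni.
pose D : set (n.+1.-tuple RR) := [set x | face_set e (of_tuple x)].
have mD : measurable D.
  have [_ _ pe _ _] := fe.
  by apply: polytope_measurable => // k; exact: measurable_of_tuple_coord.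
have mf : measurable_fun setT (fun x : n.+1.-tuple RR => (f (of_tuple x))%:E).
  apply/measurable_EFinP; apply: polynomial_measurable => // k.
  exact: measurable_of_tuple_coord.
pose nu k := measure_function_pushforward__canonical__measure_function_Measure
    (lebesgue_tuple n) (measurable_graph_tuple e k).
have inv_ge0 k : 0 <= `|face_normal e 0 k|^-1 by rewrite invr_ge0.
have key k : face_normal e 0 k != 0 ->
    (`|face_normal e 0 k|^-1 *
     \int[lebesgue_tuple n]_(t in [set t | face_set e (graph_point e k t)])
       f (graph_point e k t))%:E
    = (\int[mscale (NngNum (inv_ge0 k)) (nu k)]_(x in D) (f (of_tuple x))%:E)%E.
  move=> nk.
  have intf := face_integrable k fe Pf.
  have DE : graph_tuple e k @^-1` D = [set t | face_set e (graph_point e k t)].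
    by apply/seteqP; split => t /=; rewrite /D /= graph_tupleE.
  have intf' : (lebesgue_tuple n).-integrable (graph_tuple e k @^-1` D)
      ((fun x => (f (of_tuple x))%:E) \o graph_tuple e k).
    rewrite DE; move: intf; congr (integrable _ _ _).
    by apply/funext => t /=; rewrite graph_tupleE.
  have intnu : (nu k).-integrable D (fun x => (f (of_tuple x))%:E).
    exact: (integrable_pushforward (measurable_graph_tuple e k) mf intf' mD).
  rewrite (integral_mscale _ mD intnu).
  rewrite EFinM; congr (_ * _)%E.
  rewrite (integral_pushforward (measurable_graph_tuple e k) mf intf' mD).
  rewrite fineK; last first.
    exact: (integrable_fin_num (face_measurable k fe) intf).
  by rewrite DE; apply: eq_integral => t _ /=; rewrite graph_tupleE.
apply: EFin_inj; rewrite key// key//.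
apply: eq_measure_integral => A mA _; rewrite /mscale /= /pushforward.
exact: graph_measure_swap.
Qed.

Lemma face_integralB n (e : @flat_face R n.+1) (f g : 'rV[R]_n.+1 -> R) :
  is_flat_face e -> polynomial_fun f -> polynomial_fun g ->
  face_integral e (fun x => f x - g x) = face_integral e f - face_integral e g.
Proof.
move=> fe Pf Pg; rewrite /face_integral; case: pickP => [j nj|]; last by rewrite subr0.
rewrite RintegralB ?mulrBr//.
- exact: face_measurable.
- exact: face_integrable.
- exact: face_integrable.
Qed.

Lemma face_integralD n (e : @flat_face R n.+1) (f g : 'rV[R]_n.+1 -> R) :
  is_flat_face e -> polynomial_fun f -> polynomial_fun g ->
  face_integral e (fun x => f x + g x) = face_integral e f + face_integral e g.
Proof.
move=> fe Pf Pg; rewrite /face_integral; case: pickP => [j nj|]; last by rewrite addr0.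
rewrite RintegralD ?mulrDr//.
- exact: face_measurable.
- exact: face_integrable.
- exact: face_integrable.
Qed.

Lemma face_integralZ n (e : @flat_face R n.+1) (a : R) (f : 'rV[R]_n.+1 -> R) :
  is_flat_face e -> polynomial_fun f ->
  face_integral e (fun x => a * f x) = a * face_integral e f.
Proof.
move=> fe Pf; rewrite /face_integral; case: pickP => [j nj|]; last by rewrite mulr0.
rewrite RintegralZl; first by rewrite mulrCA.
- exact: face_measurable.
- exact: face_integrable.
Qed.

End independence.

(** * The divergence theorem on a polytope *)

(** K is an open polytope whose boundary is the union of the faces F a with
    P a; the sign eps a turns the normal of F a into the outward normal of K. *)
Section divergence.
Context {R : realType} {n : nat}.
Local Notation E := 'rV[R]_n.+1.
Local Notation RR := (measurableTypeR R).
Variables (i : 'I_n.+1) (K : set E) (I : finType) (P : pred I)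
  (F : I -> @flat_face R n.+1) (eps : I -> R).
Hypothesis K_open : open K.
Hypothesis K_polytope : polytope (closure K).
Hypothesis F_flat : forall a, P a -> is_flat_face (F a).
Hypothesis eps_unit : forall a, P a -> eps a = 1 \/ eps a = -1.
Hypothesis frontierE : frontier K = [set x | exists2 a, P a & face_set (F a) x].
Hypothesis F_normal : forall a x, P a -> relint (F a) x ->
  outward_normal K x (eps a *: face_normal (F a)).
Hypothesis F_disjoint : forall a b, P a -> P b -> a != b ->
  relint (F a) `&` relint (F b) = set0.

Let normal a : R := face_normal (F a) 0 i.

Let K_bounded : exists M, forall x, K x -> forall j, `|x 0 j| <= M.
Proof.
have [M hM] := polytope_bounded K_polytope.
by exists M => x /subset_closure; exact: hM.
Qed.

(** K is the closed polytope [closure K] minus the polytopes that make up its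
    frontier. *)
Lemma elem_measurable : measurable [set x : n.+1.-tuple RR | K (of_tuple x)].
Proof.
have intK : K° = K by apply/interior_id.
have mX j : measurable_fun [set: n.+1.-tuple RR] (fun t : n.+1.-tuple RR =>
  of_tuple t 0 j : RR).
  exact: measurable_of_tuple_coord.
rewrite (_ : [set x | _] = [set x : n.+1.-tuple RR | closure K (of_tuple x)] `\`
    \bigcup_(a in [set a | P a]) [set x : n.+1.-tuple RR | face_set (F a)
      (of_tuple x)]).
  apply: measurableD; first exact: polytope_measurable.
  apply: fin_bigcup_measurable => // a Pa.
  by have [_ _ pa _ _] := F_flat Pa; exact: polytope_measurable.
apply/seteqP; split => x /=.
  move=> Kx; split; first exact: subset_closure.
  move=> [a Pa Fx]; have : frontier K (of_tuple x) by rewrite frontierE; exists a.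
  by move=> -[_]; rewrite intK.
move=> [cKx nF]; apply: contrapT => nK; apply: nF.
have : frontier K (of_tuple x) by split => //; rewrite intK.
by rewrite frontierE => -[a Pa Fx]; exists a.
Qed.

Lemma elem_integrable (f : E -> R) : polynomial_fun f ->
  (lebesgue_tuple n.+1).-integrable [set x | K (of_tuple x)] (EFin \o (fun x =>
    f (of_tuple x))).
Proof.
move=> Pf; have [M hM] := K_bounded.
apply: (@polynomial_integrable _ _ _ _ K M) => //.
- exact: measurable_of_tuple_coord.
- by move=> t l; exists l; rewrite mxE.
- exact: elem_measurable.
Qed.

(** All the faces met by the line over t in direction i, if that line is
    transverse; [graph_point] makes sense for these faces, as n_i != 0. *)
Definition crossed (t : n.-tuple R) : pred I :=
  fun a => [&& P a, normal a != 0 & `[< face_set (F a) (graph_point (F a) i t) >]].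

Let transverse (t : n.-tuple R) := forall a, P a ->
  forall s, face_set (F a) (line i t s) -> normal a != 0 /\ relint (F a) (line i t s).

(** Off the crossed faces the line stays in K or in its complement.  Where it
    crosses F a, it does so at a point of the relative interior; near this point, K
    is a half-space whose outward normal is eps a times the normal of F a, so that
    the line leaves K when eps a * n_i > 0 and enters it when eps a * n_i < 0. *)
Lemma slice_integral (t : n.-tuple R) (f f' : E -> R) :
  transverse t -> polynomial_fun f -> polynomial_fun f' ->
  (forall x, is_derive x (delta_mx 0 i : E) f (f' x)) ->
  \int[lebesgue_measure]_(s in [set s | K (line i t s)]) f' (line i t s) =
  \sum_(a | crossed t a) eps a * Num.sg (normal a) * f (graph_point (F a) i t).
Proof.
move=> trt Pf Pf' df.
have relint_cross a : crossed t a -> relint (F a) (line i t (height (F a) i t)).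
  move=> /and3P[Pa _ /asboolP]; rewrite graph_pointE => Fa.
  by have [] := trt a Pa _ Fa.
have -> : \sum_(a | crossed t a) eps a * Num.sg (normal a) * f (graph_point (F a) i t) =
    \sum_(a | crossed t a) eps a * Num.sg (normal a) * (f \o line i t) (height (F a)
      i t).
  by apply: eq_bigr => a _; rewrite graph_pointE.
apply: (@integral_deriv_slice R I (crossed t) (fun a => height (F a) i t)
  (fun a => eps a * Num.sg (normal a)) [set s | K (line i t s)] _ _ _ _ _
  (f \o line i t) (f' \o line i t)).
- have [M hM] := K_bounded; exists (M + 1) => s /= /hM /(_ i).
  by rewrite line_id => h; rewrite ltr_pwDr.
- move=> s off.
  have nfr : ~ frontier K (line i t s).
    rewrite frontierE => -[a Pa Fs]; have [na _] := trt a Pa _ Fs.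
    have [se Fg] := (face_line t s (F_flat Pa) na).1 Fs.
    have : crossed t a by apply/and3P; split => //; apply/asboolP.
    by move/off; rewrite se eqxx.
  have [Ks|nKs] := pselect (K (line i t s)).
    have : \forall u \near s, K (line i t u).
      have nK : nbhs (line i t s) K by exact: open_nbhs_nbhs.
      exact: line_near.
    by apply: filterS => u Ku; split.
  have ncK : ~ closure K (line i t s).
    by move=> cK; apply: nfr; split => //; move/interior_subset.
  have : \forall u \near s, ~ closure K (line i t u).
    have nK : nbhs (line i t s) (~` closure K).
      by apply: open_nbhs_nbhs; split => //; apply: closed_openC; exact: closed_closure.
    exact: (line_near nK).
  by apply: filterS => u nu; split => // Ku; case: nu; exact: subset_closure.
- move=> a /and3P[Pa na _].
  have [->|->] := eps_unit Pa; have [h|h|h] := ltgtP (normal a) 0.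
  + by right; rewrite ltr0_sg// mul1r.
  + by left; rewrite gtr0_sg// mul1r.
  + by rewrite h eqxx in na.
  + by left; rewrite ltr0_sg// mulrNN mul1r.
  + by right; rewrite gtr0_sg// mulr1.
  + by rewrite h eqxx in na.
- move=> a ca; have /and3P[Pa na _] := ca.
  have [_ [delta d0 hd]] := F_normal Pa (relint_cross a ca).
  have : \forall u \near height (F a) i t, `|u - height (F a) i t| < delta.
    by apply/nbhs_ballP; exists delta => // u /=; rewrite /ball /= distrC.
  apply: filterS => u hu.
  have /hd : enorm (line i t u - line i t (height (F a) i t))
    < delta by rewrite line_enorm.
  rewrite (_ : dot _ _ =
    `|normal a| * (eps a * Num.sg (normal a) * (u - height (F a) i t))).
    by rewrite pmulr_rlt0// normr_gt0.
  rewrite dotB !dot_line !mxE -/(normal a) -[in LHS](mulr_sg_norm (normal a)).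
  by ring.
- move=> a b ca cb hab; apply/eqP; apply: contrapT => /negP ab.
  have ra := relint_cross a ca; have rb := relint_cross b cb.
  have /and3P[Pa _ _] := ca; have /and3P[Pb _ _] := cb.
  rewrite hab in ra.
  have : (relint (F a) `&` relint (F b)) (line i t (height (F b) i t)) by [].
  by rewrite F_disjoint.
- by move=> s; exact: is_derive_line.
- exact: polynomial_line_continuous.
Qed.

(** Integrate [slice_integral] over the transverse lines.  The factor sg n_i it
    contains is n_i / |n_i|, and 1 / |n_i| is the surface density of a face
    projected along axis i.  Faces with n_i = 0 contribute to neither side. *)
Theorem divergence_theorem (f : E -> R) : polynomial_fun f ->
  volume_integral K (fun x => 'D_(delta_mx 0 i) f x) =
  \sum_(a | P a) eps a * (normal a * face_integral (F a) f).
Proof.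
move=> Pf; have [f' Pf' df] := polynomial_derive i Pf.
have -> : (fun x : E => 'D_(delta_mx 0 i) f x) = f'.
  by apply/funext => x; case: (df x).
pose D := [set x : n.+1.-tuple RR | K (of_tuple x)].
pose h := (EFin \o (fun x => f' (of_tuple x))) \_ D.
have mD : measurable D by exact: elem_measurable.
have inth : (lebesgue_tuple n.+1).-integrable setT h.
  apply/integrable_restrict => //; rewrite setTI; exact: elem_integrable.
pose q a (t : n.-tuple RR) : R := (fun t => f (graph_point (F a) i t)) \_
  [set t | face_set (F a) (graph_point (F a) i t)] t.
have mface a : P a -> measurable [set t : n.-tuple RR | face_set (F a)
  (graph_point (F a) i t)].
  by move=> Pa; exact: face_measurable (F_flat Pa).
have intq a : P a -> (lebesgue_tuple n).-integrable setT (EFin \o q a).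
  move=> Pa; rewrite /q -restrict_EFin; apply/integrable_restrict => //;
    first exact: mface.
  by rewrite setTI; exact: face_integrable (F_flat Pa) Pf.
pose G (t : n.-tuple RR) : R :=
  \sum_(a | P a && (normal a != 0)) eps a * Num.sg (normal a) * q a t.
have intcq a : P a && (normal a != 0) -> (lebesgue_tuple n).-integrable setT
    (EFin \o (fun t => eps a * Num.sg (normal a) * q a t)).
  move=> /andP[Pa _].
  rewrite (_ : _ \o _ = fun t =>
    (eps a * Num.sg (normal a))%R%:E * (EFin \o q a) t)%E//.
  by apply: integrableZl => //; exact: intq.
have intG : (lebesgue_tuple n).-integrable setT (EFin \o G).
  rewrite (_ : _ \o _ = fun t => (\sum_(a | P a && (normal a != 0)%R)
      (EFin \o (fun t => (eps a * Num.sg (normal a) * q a t)%R)) t)%E).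
    exact: integrable_sum.
  by apply/funext => t /=; rewrite sumEFin.
have good : {ae lebesgue_tuple n, forall t : n.-tuple RR, transverse t}.
  have : {ae lebesgue_tuple n, forall t : n.-tuple RR, forall a, a \in enum P ->
      forall s, face_set (F a) (line i t s) ->
        normal a != 0 /\ relint (F a) (line i t s)}.
    by apply: ae_all_seq => a; rewrite mem_enum => Pa; exact: ae_transverse (F_flat Pa).
  by apply: filterS => t ht a Pa; apply: ht; rewrite mem_enum.
have inner_eq t : transverse t ->
    (\int[lebesgue_measure]_s h (tinsert i s t) = (G t)%:E)%E.
  move=> trt.
  pose S : set RR := [set s | K (line i t s)].
  have mS : measurable S.
    rewrite -[X in measurable X]setTI.
    exact: (measurable_tinsert1 i t measurableT mD).
  have -> : (\int[lebesgue_measure]_s h (tinsert i s t) =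
             \int[lebesgue_measure]_(s in S) (f' (line i t s))%:E)%E.
    rewrite [RHS]integral_mkcond; apply: eq_integral => s _.
    rewrite /h !patchE; have [Ks|nKs] := pselect (K (line i t s)).
      by rewrite !mem_set.
    by rewrite !memNset.
  have intS : lebesgue_measure.-integrable S (EFin \o (f' \o line i t)).
    have [M hM] := K_bounded.
    apply: (integrableS (E := `[- M, M]%classic : set RR)) => //.
      by move=> s /= /hM /(_ i); rewrite line_id in_itv /= ler_norml.
    apply: continuous_compact_integrable; first exact: segment_compact.
    by apply: continuous_subspaceT; exact: polynomial_line_continuous.
  rewrite -[LHS]fineK; last exact: (integrable_fin_num mS intS).
  congr (_%:E); rewrite -/(Rintegral _ _ _) (slice_integral trt Pf Pf' df) /G.
  rewrite /crossed (eq_bigl (fun a => (P a && (normal a != 0)) &&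
    `[< face_set (F a) (graph_point (F a) i t) >])); last by move=> a; rewrite andbA.
  rewrite big_mkcondr; apply: eq_bigr => a _.
  rewrite /q patchE; case: asboolP => h0; first by rewrite mem_set.
  by rewrite memNset// mulr0.
have -> : volume_integral K f' = \int[lebesgue_tuple n]_t G t.
  rewrite /volume_integral /Rintegral; congr fine.
  rewrite integral_mkcond (integral_tinsert i inth).
  apply: ae_eq_integral => //.
  - exact: measurable_integral_tinsert.
  - by case/integrableP : intG.
  - have [N [mN N0 sub]] := good; exists N; split => // t ht.
    by apply: sub => trt; apply: ht => _; exact: inner_eq.
rewrite /G Rintegral_sum// [RHS](bigID (fun a => normal a != 0))/=.
rewrite [X in _ = _ + X]big1 ?addr0; last first.
  by move=> a /andP[_]; rewrite negbK => /eqP ->; rewrite mul0r mulr0.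
apply: eq_bigr => a /andP[Pa na].
rewrite RintegralZl//; last exact: intq.
rewrite (face_integralE (F_flat Pa) na Pf) /q -Rintegral_mkcond.
rewrite -mulrA; congr (_ * _); rewrite mulrA; congr (_ * _).
by rewrite -/(normal a) -{2}(mulr_sg_norm (normal a)) mulfK// normr_eq0.
Qed.

End divergence.

(** * Green's formula on a mesh and discrete integration by parts *)

Section mesh.
Context {R : realType} {n : nat} {Omega : set 'rV[R]_n.+1} {Th : mesh Omega}.
Hypothesis Omega_open : open Omega.
Local Notation E := 'rV[R]_n.+1.

(** The faces of all the elements, an interior face being counted twice: the
    first summand lists the interior faces as seen from [lo], where their normal
    points outwards, and the second as seen from [hi], where it points inwards. *)
Definition side : finType := ('I_(nif Th) + 'I_(nif Th) + 'I_(nbf Th))%type.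

Definition side_of (k : 'I_(nelem Th)) : pred side := fun a =>
  match a with
  | inl (inl e) => lo e == k
  | inl (inr e) => hi e == k
  | inr e => owner e == k
  end.

Definition side_face (a : side) : @flat_face R n.+1 :=
  match a with
  | inl (inl e) => iface e
  | inl (inr e) => iface e
  | inr e => bface e
  end.

Definition side_sign (a : side) : R := if a is inl (inr _) then -1 else 1.

Lemma elem_open (k : 'I_(nelem Th)) : open (elem k).
Proof. by rewrite -elem_regular_open; exact: open_interior. Qed.

Lemma side_flat a : is_flat_face (side_face a).
Proof. by case: a => [[e|e]|e];
  [exact: iface_flat|exact: iface_flat|exact: bface_flat]. Qed.

Lemma side_frontier k :
  frontier (elem k) = [set x | exists2 a, side_of k a & face_set (side_face a) x].
Proof.
rewrite faces_cover; apply/seteqP; split => x /=.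
  move=> [[e /= [ek|ek] ex]|[e /= ek ex]].
  - by exists (inl (inl e)) => //=; apply/eqP.
  - by exists (inl (inr e)) => //=; apply/eqP.
  - by exists (inr e) => //=; apply/eqP.
move=> [[[e|e]|e] /= /eqP ek ex].
- by left; exists e => //; left.
- by left; exists e => //; right.
- by right; exists e.
Qed.

Lemma side_normal k a x : side_of k a -> relint (side_face a) x ->
  outward_normal (elem k) x (side_sign a *: face_normal (side_face a)).
Proof.
case: a => [[e|e]|e] /= /eqP <- rx; rewrite ?scale1r ?scaleN1r.
- by have [] := iface_normal rx.
- by have [] := iface_normal rx.
- by have [] := bface_normal rx.
Qed.

(** Faces of different kinds are disjoint because the relative interior of an
    interior face lies in Omega, and a boundary face in its frontier.  One element
    does not see an interior face from both sides, since [lo e] < [hi e]. *)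
Lemma side_disjoint k a b : side_of k a -> side_of k b -> a != b ->
  relint (side_face a) `&` relint (side_face b) = set0.
Proof.
have ib (e : 'I_(nif Th)) (e' : 'I_(nbf Th)) :
    relint (iface e) `&` relint (bface e') = set0.
  rewrite -subset0 => x [/iface_inside Ox [ex _]].
  have [_ [_]] := bface_sub ex.
  by rewrite (interior_id _).1.
have ii (e e' : 'I_(nif Th)) : lo e = k -> hi e' = k ->
  relint (iface e) `&` relint (iface e') = set0.
  move=> lek hek; apply: iface_disjoint; apply/eqP => ee.
  by have := lo_lt_hi e; rewrite lek ee hek ltnn.
case: a => [[e|e]|e]; case: b => [[e'|e']|e'] /= /eqP ek /eqP ek' ab.
- by apply: iface_disjoint; apply: contra ab => /eqP ->.
- exact: ii.
- exact: ib.
- by rewrite setIC; exact: ii.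
- by apply: iface_disjoint; apply: contra ab => /eqP ->.
- exact: ib.
- by rewrite setIC; exact: ib.
- by rewrite setIC; exact: ib.
- by apply: bface_disjoint; apply: contra ab => /eqP ->.
Qed.

Lemma side_sign_unit a : side_sign a = 1 \/ side_sign a = -1.
Proof. by case: a => [[e|e]|e] /=; [left|right|left]. Qed.

Lemma mesh_elem_measurable (k : 'I_(nelem Th)) :
  measurable [set x : n.+1.-tuple (measurableTypeR R) | elem k (of_tuple x)].
Proof.
apply: (@elem_measurable R n (elem k) side (side_of k) side_face) => //.
- exact: elem_open.
- exact: elem_polytope.
- by move=> a _; exact: side_flat.
- exact: side_frontier.
Qed.

Lemma mesh_elem_integrable (k : 'I_(nelem Th)) (f : E -> R) : polynomial_fun f ->
  (lebesgue_tuple n.+1).-integrable [set x | elem k (of_tuple x)] (EFin \o (fun x => f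
    (of_tuple x))).
Proof.
apply: (@elem_integrable R n (elem k) side (side_of k) side_face) => //.
- exact: elem_open.
- exact: elem_polytope.
- by move=> a _; exact: side_flat.
- exact: side_frontier.
Qed.

Lemma volume_integralD (k : 'I_(nelem Th)) (f g : E -> R) :
  polynomial_fun f -> polynomial_fun g ->
  volume_integral (elem k) (fun x => f x + g x) =
  volume_integral (elem k) f + volume_integral (elem k) g.
Proof.
move=> Pf Pg; rewrite /volume_integral RintegralD//.
- exact: mesh_elem_measurable.
- exact: mesh_elem_integrable.
- exact: mesh_elem_integrable.
Qed.

Lemma volume_integralZ (k : 'I_(nelem Th)) (a : R) (f : E -> R) :
  polynomial_fun f ->
  volume_integral (elem k) (fun x => a * f x) = a * volume_integral (elem k) f.
Proof.
move=> Pf; rewrite /volume_integral RintegralZl//.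
- exact: mesh_elem_measurable.
- exact: mesh_elem_integrable.
Qed.

Lemma elem_divergence (i : 'I_n.+1) (k : 'I_(nelem Th)) (f : E -> R) :
  polynomial_fun f ->
  volume_integral (elem k) (fun x => 'D_(delta_mx 0 i) f x) =
  \sum_(e < nif Th | lo e == k) face_normal (iface e) 0 i * face_integral (iface e) f -
  \sum_(e < nif Th | hi e == k) face_normal (iface e) 0 i * face_integral (iface e) f +
  \sum_(e < nbf Th | owner e == k)
    face_normal (bface e) 0 i * face_integral (bface e) f.
Proof.
move=> Pf.
rewrite (@divergence_theorem R n i (elem k) side (side_of k) side_face side_sign)//.
- rewrite big_sumType big_sumType /= -sumrN.
  by congr (_ + _ + _); apply: eq_bigr => e _; rewrite ?mul1r ?mulN1r.
- exact: elem_open.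
- exact: elem_polytope.
- by move=> a _; exact: side_flat.
- by move=> a _; exact: side_sign_unit.
- exact: side_frontier.
- exact: side_normal.
- exact: side_disjoint.
Qed.

Definition piecewise_polynomial (v : pw Th) := forall k, polynomial_fun (v k).

Lemma Vh_polynomial r (v : pw Th) : Vh r v -> piecewise_polynomial v.
Proof. by move=> hv k; exact: poly_fun_polynomial (hv k). Qed.

Lemma innerC (v w : pw Th) : inner v w = inner w v.
Proof.
by apply: eq_bigr => k _; congr volume_integral; apply/funext => x; rewrite mulrC.
Qed.

(** Sum the divergence theorem for v phi over the elements, and collect for each
    face the contributions of the elements that own it. *)
Lemma green (i : 'I_n.+1) (v phi : pw Th) :
  piecewise_polynomial v -> piecewise_polynomial phi ->
  inner v (pw_partial i phi) + inner phi (pw_partial i v) =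
  \sum_(e < nif Th) face_integral (iface e) (fun x => face_normal (iface e) 0 i *
     (v (lo e) x * phi (lo e) x - v (hi e) x * phi (hi e) x)) + boundary_term i v phi.
Proof.
move=> Pv Pphi; pose p k x := v k x * phi k x.
have Pp k : polynomial_fun (p k) by exact: polynomial_mul.
transitivity (\sum_k volume_integral (elem k) (fun x => 'D_(delta_mx 0 i) (p k) x)).
  rewrite -big_split /=; apply: eq_bigr => k _.
  have [v' Pv' dv] := polynomial_derive i (Pv k).
  have [phi' Pphi' dphi] := polynomial_derive i (Pphi k).
  have vE x : pw_partial i v k x = v' x by rewrite /pw_partial; case: (dv x).
  have phiE x : pw_partial i phi k x = phi' x by rewrite /pw_partial; case: (dphi x).
  have pE x : 'D_(delta_mx 0 i) (p k) x = v k x * phi' x + phi k x * v' x.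
    by have [_ <-] := is_deriveM (dv x) (dphi x).
  under eq_fun do rewrite phiE.
  under [X in _ + volume_integral _ X]eq_fun do rewrite vE.
  rewrite -(volume_integralD k (polynomial_mul (Pv k) Pphi') (polynomial_mul (Pphi k)
    Pv')).
  by congr volume_integral; apply/funext => x; rewrite pE.
under eq_bigr do rewrite elem_divergence//.
rewrite big_split/= sumrB.
have part (J : finType) (own : J -> 'I_(nelem Th)) (X : J -> 'I_(nelem Th) -> R) :
    \sum_k \sum_(e | own e == k) X e k = \sum_e X e (own e).
  rewrite (exchange_big_dep xpredT)//=; apply: eq_bigr => e _.
  by rewrite (big_pred1 (own e))// => k; rewrite eq_sym.
rewrite (part _ (fun e => lo e) (fun e k =>
  face_normal (iface e) 0 i * face_integral (iface e) (p k))).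
rewrite (part _ (fun e => hi e) (fun e k =>
  face_normal (iface e) 0 i * face_integral (iface e) (p k))).
rewrite (part _ (fun e => owner e) (fun e k =>
  face_normal (bface e) 0 i * face_integral (bface e) (p k))).
congr (_ + _).
  rewrite -sumrB; apply: eq_bigr => e _.
  rewrite -mulrBr -face_integralB//; last exact: iface_flat.
  rewrite -face_integralZ//; first exact: iface_flat.
  apply: polynomial_add => //.
  rewrite (_ : (fun _ => _) = fun x => -1 * p (hi e) x); last by apply/funext => x;
    rewrite mulN1r.
  by apply: polynomial_mul => //; exact: polynomial_cst.
apply: eq_bigr => e _; rewrite -(face_integralZ _ (bface_flat e) (Pp _)).
by congr face_integral; apply/funext => x; rewrite /p; ring.
Qed.

Lemma polynomial_jump (v : pw Th) e : piecewise_polynomial v ->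
  polynomial_fun (jump v e).
Proof.
move=> Pv; apply: polynomial_add; first exact: Pv.
rewrite (_ : (fun _ => _) = fun x => -1 * v (hi e) x); last by apply/funext => x;
  rewrite mulN1r.
by apply: polynomial_mul; [exact: polynomial_cst|exact: Pv].
Qed.

Lemma polynomial_trace s i (v : pw Th) e : piecewise_polynomial v ->
  polynomial_fun (trace_Q s i v e).
Proof. by move=> Pv; case: s; rewrite /trace_Q;
  case: (face_normal (iface e) 0 i < 0); exact: Pv. Qed.

(** Pointwise, Q^s(v) [phi] + Q^(-s)(phi) [v] = [v phi]: the two traces are taken
    from opposite sides of the face. *)
Lemma trace_pairing s i (v phi : pw Th) :
  piecewise_polynomial v -> piecewise_polynomial phi ->
  interior_pairing (fun e x =>
    trace_Q s i v e x * face_normal (iface e) 0 i) (jump phi) +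
  interior_pairing (fun e x =>
    trace_Q (opp_sgn s) i phi e x * face_normal (iface e) 0 i) (jump v) =
  \sum_(e < nif Th) face_integral (iface e) (fun x => face_normal (iface e) 0 i *
     (v (lo e) x * phi (lo e) x - v (hi e) x * phi (hi e) x)).
Proof.
move=> Pv Pphi; rewrite -big_split /=; apply: eq_bigr => e _.
rewrite -face_integralD; first last.
- apply: polynomial_mul; last exact: polynomial_jump.
  by apply: polynomial_mul; [exact: polynomial_trace|exact: polynomial_cst].
- apply: polynomial_mul; last exact: polynomial_jump.
  by apply: polynomial_mul; [exact: polynomial_trace|exact: polynomial_cst].
- exact: iface_flat.
congr face_integral; apply/funext => x; rewrite /jump /trace_Q.
by case: s => /=; case: ifP => _; ring.
Qed.

Lemma penalty_pairing (g g' : 'I_(nif Th) -> R) (v phi : pw Th) :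
  (forall e, g' e = - g e) ->
  piecewise_polynomial v -> piecewise_polynomial phi ->
  interior_pairing (fun e x => g e * jump v e x) (jump phi) +
  interior_pairing (fun e x => g' e * jump phi e x) (jump v) = 0.
Proof.
move=> gg Pv Pphi; rewrite -big_split /= big1// => e _.
have Pj : polynomial_fun (fun x => jump v e x * jump phi e x).
  by apply: polynomial_mul; exact: polynomial_jump.
have fe := iface_flat e.
rewrite (_ : (fun x => g e * _ * _) = fun x => g e * (jump v e x * jump phi e x));
  last first.
  by apply/funext => x; rewrite mulrA.
rewrite (_ : (fun x => g' e * _ * _) = fun x => - g e * (jump v e x * jump phi e x));
  last first.
  by apply/funext => x; rewrite gg; ring.
by rewrite !face_integralZ// mulNr subrr.
Qed.

Lemma boundary_pairingE i (v phi : pw Th) :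
  boundary_pairing (fun e x => v (owner e) x * face_normal (bface e) 0 i)
    (fun e => phi (owner e)) = boundary_term i v phi.
Proof.
by apply: eq_bigr => e _; congr face_integral; apply/funext => x; rewrite mulrAC mulrA.
Qed.

Lemma boundary_termC i (v phi : pw Th) : boundary_term i v phi = boundary_term i phi v.
Proof.
by apply: eq_bigr => e _; congr face_integral; apply/funext => x; rewrite mulrCA.
Qed.

Lemma one_sided_by_parts r s i (gamma : sgn -> 'I_(nif Th) -> R) (v phi : pw Th)
    (dv dphi : pw Th) :
  (forall e, gamma Plus e = - gamma Minus e) -> Vh r v -> Vh r phi ->
  is_discrete_derivative r s i (gamma s) v dv ->
  is_discrete_derivative r (opp_sgn s) i (gamma (opp_sgn s)) phi dphi ->
  inner dv phi = - inner v dphi + boundary_term i v phi.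
Proof.
move=> gE Vv Vphi [_ /(_ _ Vphi) ->] [_ /(_ _ Vv)]; rewrite innerC => ->.
have Pv := Vh_polynomial Vv; have Pphi := Vh_polynomial Vphi.
have T := trace_pairing s i Pv Pphi.
have G := green i Pv Pphi.
have ggE e : gamma (opp_sgn s) e = - gamma s e.
  by case: s {T} => /=; rewrite gE ?opprK.
have Z := penalty_pairing ggE Pv Pphi.
rewrite !boundary_pairingE [boundary_term i phi v]boundary_termC.
have arith (A A' B V V' P P' S : R) : A + A' = S -> V + V' = S + B -> P + P' = 0 ->
    A + B - V + P = - (A' + B - V' + P') + B.
  by move=> /(canRL (addrK _)) -> /(canRL (addrK _)) -> /(canRL (addrK _)) ->; ring.
exact: arith T G Z.
Qed.

Lemma inner_central (dv : sgn -> pw Th) (w : pw Th) :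
  (forall s, piecewise_polynomial (dv s)) -> piecewise_polynomial w ->
  inner (central dv) w = 2^-1 * (inner (dv Minus) w + inner (dv Plus) w).
Proof.
move=> Pdv Pw; rewrite -big_split /= mulr_sumr; apply: eq_bigr => k _.
have PM : polynomial_fun (fun x => dv Minus k x * w k x).
  by apply: polynomial_mul; [exact: Pdv|exact: Pw].
have PP : polynomial_fun (fun x => dv Plus k x * w k x).
  by apply: polynomial_mul; [exact: Pdv|exact: Pw].
rewrite -volume_integralD// -volume_integralZ; last exact: polynomial_add.
by congr volume_integral; apply/funext => x; rewrite /central; ring.
Qed.

End mesh.

Theorem theorem4p4 (R : realType) (d r : nat)
  (Omega : set 'rV[R]_d) (hOmega : bounded_domain Omega)
  (Th : mesh Omega) (sigma rho : R)
  (hshape : shape_regular Th sigma) (hquasi : locally_quasi_uniform Th rho)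
  (i : 'I_d) (gamma : sgn -> 'I_d -> 'I_(nif Th) -> R)
  (hgamma : forall e : 'I_(nif Th), gamma Plus i e = - gamma Minus i e)
  (v phi : pw Th) (hv : Vh r v) (hphi : Vh r phi)
  (dv dphi : sgn -> pw Th)
  (hdv : forall s : sgn, is_discrete_derivative r s i (gamma s i) v (dv s))
  (hdphi : forall s : sgn,
     is_discrete_derivative r s i (gamma s i) phi (dphi s)) :
  (forall s : sgn,
     inner (dv s) phi = - inner v (dphi (opp_sgn s)) + boundary_term i v phi) /\
  inner (central dv) phi = - inner v (central dphi) + boundary_term i v phi.
Proof.
destruct d as [|n]; first (by have := ltn_ord i).
case: (hOmega) => Omega_open _ _ _.
have parts s : inner (dv s) phi = - inner v (dphi (opp_sgn s)) + boundary_term i v phi.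
  exact: (one_sided_by_parts Omega_open (gamma := fun s =>
    gamma s i) (r := r) (s := s)).
split=> //.
have Pdv s : piecewise_polynomial (dv s) by apply: (@Vh_polynomial _ _ _ _ r);
  case: (hdv s).
have Pdphi s : piecewise_polynomial (dphi s) by apply: (@Vh_polynomial _ _ _ _ r);
  case: (hdphi s).
rewrite [inner v _]innerC !inner_central//; last 2 first.
- exact: Vh_polynomial hv.
- exact: Vh_polynomial hphi.
rewrite !parts /= ![inner v _]innerC; lra.
Qed.
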